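(* For all $r>0$ there exists some Zariski-dense finitely supported probability measure $\mu$ on $\mathrm{PSL}_2(\mathbb{R})$ such that all the elements in the support of $\mu$ are conjugate to a diagonal matrix with largest entry at least $r$ under conjugation by a rotation, and the Furstenberg measure generated by $\mu$ is absolutely continuous.
   Context: A probability measure $\mu$ on $\mathrm{PSL}_2(\mathbb{R})$ is Zariski-dense if its support is not contained in a compact subgroup and no finite (non-empty) subset of $P^1(\mathbb{R})$ is invariant under the support of $\mu$. The Furstenberg measure generated by such a $\mu$ is the unique probability measure $\nu$ on $P^1(\mathbb{R})$ with $\nu=\mu*\nu$. Absolute continuity is with respect to the Lebesgue measure class on $P^1(\mathbb{R})$. A rotation is the class in $\mathrm{PSL}_2(\mathbb{R})$ of a matrix $\begin{pmatrix}\cos x&-\sin x\\ \sin x&\cos x\end{pmatrix}$. *)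

(* Defs.v *)
From HB Require Import structures.
From mathcomp Require Import all_boot all_order all_algebra.
From mathcomp Require Import all_classical all_reals all_analysis.

Set Implicit Arguments.
Unset Strict Implicit.
Unset Printing Implicit Defensive.

Import Order.TTheory GRing.Theory Num.Theory.
Import numFieldNormedType.Exports.

Local Open Scope classical_set_scope.
Local Open Scope quotient_scope.
Local Open Scope ring_scope.

Notation borel T := (g_sigma_algebraType (@open T)).

Definition msupport (R : realType) (T : ptopologicalType)
    (mu : probability (borel T) R) : set T :=
  [set x | forall U : set T, open U -> U x -> (0 < mu U)%E].

Definition subgroup (G : groupType) (H : set G) : Prop :=
  H 1%g /\ forall x y, H x -> H y -> H (x * y^-1)%g.

Section SL2.
Variable R : realType.

Definition SL2 : Type := {M : 'M[R]_2 | \det M == 1}.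

HB.instance Definition _ := SubType.on SL2.
HB.instance Definition _ := Choice.on SL2.
HB.instance Definition _ :=
  Topological.copy SL2 (initial_topology (val : SL2 -> 'M[R]_2)).

Lemma SL2_det (M : SL2) : \det (val M) = 1.
Proof. exact/eqP/(valP M). Qed.

Lemma SL2_unit (M : SL2) : val M \in unitmx.
Proof. by rewrite unitmxE SL2_det unitr1. Qed.

Fact SL2_one_subproof : \det (1%:M : 'M[R]_2) == 1.
Proof. by rewrite det1. Qed.

Fact SL2_mul_subproof (M N : SL2) : \det (val M *m val N) == 1.
Proof. by rewrite det_mulmx !SL2_det mulr1. Qed.

Fact SL2_inv_subproof (M : SL2) : \det (invmx (val M)) == 1.
Proof. by rewrite det_inv SL2_det invr1. Qed.

Fact SL2_opp_subproof (M : SL2) : \det (- val M) == 1.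
Proof. by rewrite -scaleN1r detZ SL2_det mulr1 sqrrN expr1n. Qed.

Definition SL2_one : SL2 := Sub 1%:M SL2_one_subproof.
Definition SL2_mul (M N : SL2) : SL2 :=
  Sub (val M *m val N) (SL2_mul_subproof M N).
Definition SL2_inv (M : SL2) : SL2 := Sub (invmx (val M)) (SL2_inv_subproof M).
Definition SL2_opp (M : SL2) : SL2 := Sub (- val M) (SL2_opp_subproof M).

Fact SL2_mulA : associative SL2_mul.
Proof. by move=> M N P; apply: val_inj; rewrite /= mulmxA. Qed.
Fact SL2_mul1 : left_id SL2_one SL2_mul.
Proof. by move=> M; apply: val_inj; rewrite /= mul1mx. Qed.
Fact SL2_mulr1 : right_id SL2_one SL2_mul.
Proof. by move=> M; apply: val_inj; rewrite /= mulmx1. Qed.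
Fact SL2_mulV : left_inverse SL2_one SL2_inv SL2_mul.
Proof. by move=> M; apply: val_inj; rewrite /= mulVmx ?SL2_unit. Qed.
Fact SL2_mulrV : right_inverse SL2_one SL2_inv SL2_mul.
Proof. by move=> M; apply: val_inj; rewrite /= mulmxV ?SL2_unit. Qed.

HB.instance Definition _ :=
  isGroup.Build SL2 SL2_mulA SL2_mul1 SL2_mulr1 SL2_mulV SL2_mulrV.
HB.instance Definition _ := isPointed.Build SL2 SL2_one.

End SL2.

Section PSL2.
Variable R : realType.

Definition SL2_equiv (M N : SL2 R) : bool := (M == N) || (M == SL2_opp N).

Lemma SL2_oppK : involutive (@SL2_opp R).
Proof. by move=> M; apply: val_inj; rewrite /= opprK. Qed.

Fact SL2_equiv_equiv : equiv_class_of SL2_equiv.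
Proof.
split=> [M|M N|N M P]; rewrite /SL2_equiv ?eqxx //.
  by apply/orP/orP => -[] /eqP->; rewrite ?SL2_oppK eqxx; by [left|right].
by move=> /orP[] /eqP-> /orP[] /eqP->; rewrite ?SL2_oppK ?eqxx ?orbT.
Qed.

Canonical SL2_equiv_rel := EquivRelPack SL2_equiv_equiv.

Definition PSL2 : Type := quotient_topology {eq_quot SL2_equiv_rel}.

HB.instance Definition _ := Quotient.on PSL2.
HB.instance Definition _ := Choice.on PSL2.
HB.instance Definition _ := PointedTopological.on PSL2.

Definition PSL2_class (M : SL2 R) : PSL2 := \pi_(PSL2) M.

Lemma PSL2_classP (M N : SL2 R) :
  PSL2_class M = PSL2_class N <-> M = N \/ M = SL2_opp N.
Proof.
split=> [/eqmodP /orP[] /eqP ->|h]; [by left|by right|].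
by apply/eqmodP; rewrite /= /SL2_equiv; case: h => ->; rewrite eqxx ?orbT.
Qed.

Lemma PSL2_reprK (g : PSL2) : PSL2_class (repr g) = g.
Proof. exact: reprK. Qed.

Lemma repr_PSL2_class (M : SL2 R) :
  repr (PSL2_class M) = M \/ repr (PSL2_class M) = SL2_opp M.
Proof. by apply/PSL2_classP; rewrite PSL2_reprK. Qed.

Definition PSL2_one : PSL2 := PSL2_class 1%g.
Definition PSL2_mul (g h : PSL2) : PSL2 := PSL2_class (repr g * repr h)%g.
Definition PSL2_inv (g : PSL2) : PSL2 := PSL2_class (repr g)^-1%g.

Lemma PSL2_mul_class (M N : SL2 R) :
  PSL2_mul (PSL2_class M) (PSL2_class N) = PSL2_class (M * N)%g.
Proof.
apply/PSL2_classP.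
case: (repr_PSL2_class M) => ->; case: (repr_PSL2_class N) => ->;
  [left|right|right|left]; apply: val_inj => //=;
  by rewrite ?mulNmx ?mulmxN ?opprK.
Qed.

Lemma PSL2_inv_class (M : SL2 R) :
  PSL2_inv (PSL2_class M) = PSL2_class M^-1%g.
Proof.
apply/PSL2_classP; case: (repr_PSL2_class M) => ->; [by left|right].
apply: val_inj => /=.
rewrite -[in LHS]scaleN1r invmxZ; last by rewrite unitmxZ ?unitrN1 ?SL2_unit.
by rewrite invrN1 scaleN1r.
Qed.

Fact PSL2_mulA : associative PSL2_mul.
Proof.
move=> g h k; rewrite -(PSL2_reprK g) -(PSL2_reprK h) -(PSL2_reprK k).
by rewrite !PSL2_mul_class mulgA.
Qed.
Fact PSL2_mul1 : left_id PSL2_one PSL2_mul.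
Proof. by move=> g; rewrite -(PSL2_reprK g) PSL2_mul_class mul1g. Qed.
Fact PSL2_mulr1 : right_id PSL2_one PSL2_mul.
Proof. by move=> g; rewrite -(PSL2_reprK g) PSL2_mul_class mulg1. Qed.
Fact PSL2_mulV : left_inverse PSL2_one PSL2_inv PSL2_mul.
Proof.
by move=> g; rewrite -(PSL2_reprK g) PSL2_inv_class PSL2_mul_class mulVg.
Qed.
Fact PSL2_mulrV : right_inverse PSL2_one PSL2_inv PSL2_mul.
Proof.
by move=> g; rewrite -(PSL2_reprK g) PSL2_inv_class PSL2_mul_class mulgV.
Qed.

HB.instance Definition _ :=
  isGroup.Build PSL2 PSL2_mulA PSL2_mul1 PSL2_mulr1 PSL2_mulV PSL2_mulrV.

End PSL2.

Section projective_line.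
Variable R : realType.

Definition nzvec : Type := {v : 'cV[R]_2 | v != 0}.

HB.instance Definition _ := SubType.on nzvec.
HB.instance Definition _ := Choice.on nzvec.
HB.instance Definition _ :=
  Topological.copy nzvec (initial_topology (val : nzvec -> 'cV[R]_2)).

Definition vec2 (x y : R) : 'cV[R]_2 := \col_i (if i == 0 then x else y).

Fact vec_circle_subproof (t : R) : vec2 (cos t) (sin t) != 0.
Proof.
apply/eqP => /matrixP h; have := cos2Dsin2 t.
have := h 0 0; have := h 1 0; rewrite !mxE /= => -> ->.
by rewrite expr0n addr0 => /esym/eqP; rewrite oner_eq0.
Qed.

Definition vec_circle (t : R) : nzvec :=
  Sub (vec2 (cos t) (sin t)) (vec_circle_subproof t).

HB.instance Definition _ := isPointed.Build nzvec (vec_circle 0).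

Definition collinear (v w : nzvec) : bool :=
  `[< exists2 c : R, c != 0 & val v = c *: val w >].

Fact collinear_equiv : equiv_class_of collinear.
Proof.
have sym (v w : nzvec) : collinear v w -> collinear w v.
  move=> /asboolP[c c0 e]; apply/asboolP; exists c^-1; first by rewrite invr_eq0.
  by rewrite e scalerA mulVf // scale1r.
split=> [v|v w|w v u].
- by apply/asboolP; exists 1; rewrite ?oner_eq0 // scale1r.
- by apply/idP/idP; exact: sym.
- move=> /asboolP[c c0 e] /asboolP[d d0 e']; apply/asboolP; exists (c * d).
    by rewrite mulf_neq0.
  by rewrite e e' scalerA.
Qed.

Canonical collinear_rel := EquivRelPack collinear_equiv.

Definition P1 : Type := quotient_topology {eq_quot collinear_rel}.

HB.instance Definition _ := Quotient.on P1.
HB.instance Definition _ := Choice.on P1.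
HB.instance Definition _ := PointedTopological.on P1.

Definition P1_line (v : nzvec) : P1 := \pi_(P1) v.

Fact SL2_act_subproof (M : SL2 R) (v : nzvec) : val M *m val v != 0.
Proof.
apply: contra_neq (valP v) => h.
by rewrite -[LHS](mulKmx (SL2_unit M)) h mulmx0.
Qed.

Definition SL2_act (M : SL2 R) (v : nzvec) : nzvec :=
  Sub (val M *m val v) (SL2_act_subproof M v).

Lemma val_SL2_act (M : SL2 R) (v : nzvec) :
  val (SL2_act M v) = val M *m val v.
Proof. by []. Qed.

Definition PSL2_act (g : PSL2 R) (x : P1) : P1 :=
  P1_line (SL2_act (repr g) (repr x)).

Lemma PSL2_act_class (M : SL2 R) (v : nzvec) :
  PSL2_act (PSL2_class M) (P1_line v) = P1_line (SL2_act M v).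
Proof.
apply/eqmodP; rewrite /=.
have : collinear (repr (P1_line v)) v by apply/eqmodP; exact: reprK.
move=> /asboolP[c c0 e]; apply/asboolP.
case: (repr_PSL2_class M) => eM.
  by exists c => //; rewrite !val_SL2_act e eM -scalemxAr.
by exists (- c); rewrite ?oppr_eq0 // !val_SL2_act e eM mulNmx -scalemxAr scaleNr.
Qed.

(* The angle t in [0, pi[ parametrizes the lines bijectively, so this is the
   rotation-invariant measure of total mass pi, which represents the Lebesgue
   measure class. *)
Definition P1_lebesgue (A : set (borel P1)) : \bar R :=
  lebesgue_measure
    ([set t : R | 0 <= t < pi /\ A (P1_line (vec_circle t))] : set R).

End projective_line.

Section furstenberg.
Variable R : realType.
Implicit Types (mu : probability (borel (PSL2 R)) R)
  (nu : probability (borel (P1 R)) R).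

Definition zariski_dense mu : Prop :=
  ~ (exists K : set (PSL2 R),
       [/\ subgroup K, compact K & msupport mu `<=` K]) /\
  ~ (exists F : set (P1 R),
       [/\ finite_set F, F !=set0 &
           forall g, msupport mu g -> PSL2_act g @` F = F]).

Definition convolution mu nu : set (borel (P1 R)) -> \bar R :=
  pushforward (mu \x nu)%E (fun gx => PSL2_act gx.1 gx.2 : borel (P1 R)).

Definition stationary mu nu : Prop :=
  forall A : set (borel (P1 R)), measurable A -> nu A = convolution mu nu A.

(* Uniqueness is equality on Borel sets: a measure, as a set function, is
   not determined outside of its sigma-algebra. *)
Definition is_furstenberg_measure mu nu : Prop :=
  stationary mu nu /\
  forall nu' : probability (borel (P1 R)) R, stationary mu nu' ->
    forall A : set (borel (P1 R)), measurable A -> nu' A = nu A.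

End furstenberg.

Section special_elements.
Variable R : realType.

Definition rot_mx (x : R) : 'M[R]_2 :=
  \matrix_(i, j) (if i == j then cos x
                  else if i == 0 then - sin x else sin x).

Fact rot_subproof (x : R) : \det (rot_mx x) == 1.
Proof.
rewrite (expand_det_row _ 0) !big_ord_recl big_ord0 /cofactor !det_mx11 !mxE /=.
by rewrite addr0 expr0 expr1 mul1r mulN1r mulrNN -!expr2 cos2Dsin2.
Qed.

Definition rot (x : R) : SL2 R := Sub (rot_mx x) (rot_subproof x).

Definition is_rotation (k : PSL2 R) : Prop :=
  exists x : R, k = PSL2_class (rot x).

(* An element of PSL2 has two representatives, D and -D; for positive r, only
   the one with positive diagonal entries can satisfy the bound. *)
Definition is_diag_ge (r : R) (d : PSL2 R) : Prop :=
  exists D : SL2 R, [/\ d = PSL2_class D, is_diag_mx (val D) &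
    r <= Num.max (val D 0 0) (val D 1 1)].

End special_elements.

(* Main.v *)
From HB Require Import structures.
From mathcomp Require Import all_boot all_order all_algebra.
From mathcomp Require Import all_classical all_reals all_analysis.
From mathcomp Require Import measurable_realfun.
From mathcomp Require Import ring lra.
Require Import Defs.

Set Implicit Arguments.
Unset Strict Implicit.
Unset Printing Implicit Defensive.

Import Order.TTheory GRing.Theory Num.Theory.
Import numFieldNormedType.Exports.
Local Open Scope classical_set_scope.
Local Open Scope ring_scope.

(** The measure is the uniform measure on N + 1 matrices of one and the same
large norm l whose axes have generic directions.  In the angle coordinate of
the projective line, the positive definite matrix with eigenvalues l and 1/l
and expanding direction theta acts near theta as x |-> theta + H(x - theta)
with H = atan (l^-2 tan): the maps of the system are the conjugates, by the
translations by their parameters theta, of one map H whose slope lies between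
k and 2k, where k = l^-2 is small.

Absolute continuity comes from transversality, averaged over the parameters.
Let x(w) be the image of a base point under the composition along the word w.
Moving the parameter of the letter a by d moves x(w) by about d if w starts
with a, and by O(k d) otherwise, so that for words w, v with distinct first
letters the set of parameters with |x(w) - x(v)| < rho has proportion O(rho)
(transversality).  Decomposing pairs of words along their common prefix, and
using that the maps multiply distances by at least k, the mean over the
parameters of the proportion of rho-close pairs of words of length n is at
most (N+1)^-n plus O(rho) times a geometric series of ratio 1/(k(N+1)), which
converges once k(N+1) >= 2 (sum_grid_near_pairs).  Hence for each n some
parameter has only O(rho) close pairs at the scale rho = (N+1)^-n; a cluster
point theta of these parameters is used (exists_limit_near_pairs).  For such a
theta, a Markov inequality shows that every stationary measure nu gives to a
finite union of intervals of total length L a mass at most S L + C/S, for all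
S > 0, so that nu vanishes on Lebesgue null sets (self_similar_null).  Finite
grids of parameters replace the integral over the parameter space.

A stationary measure on the line is the image of Lebesgue measure under the
expansion in base N + 1 followed by the coding of digit sequences by
compositions (exists_self_similar), and it is unique because the maps contract
(self_similar_unique).  On the projective line, a stationary measure cannot
charge the complement of a small arc around the expanding directions: almost
every point outside of the arc would have to stay outside under the powers of
every generator, hence be the repelling point of each of them, and two
generators with distinct non-orthogonal axes share no such point
(stationary_arc).  The same two generators exclude finite invariant sets, and
the traces of the powers of one generator exclude compact subgroups. *)

(** * Counting on finite grids *)

Section finite_counting.

Definition ffun_set (I : finType) (J : Type) (t : {ffun I -> J}) (a : I) (s : J) :
  {ffun I -> J} := [ffun i => if i == a then s else t i].

(** The map (t, s) |-> (t with t(a) := s, old value of t(a)) is an involution,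
hence the sum of F over the grid is the mean of its sums along the lines in
direction a. *)
Lemma sum_ffun_slices (R : numDomainType) (I J : finType)
    (F : {ffun I -> J} -> R) (a : I) (c : R) :
  (forall t, \sum_s F (ffun_set t a s) <= c) ->
  #|J|%:R * (\sum_t F t) <= c * #|{ffun I -> J}|%:R.
Proof.
move=> Hc.
pose inv (p : {ffun I -> J} * J) := (ffun_set p.1 a p.2, p.1 a).
have invK : involutive inv.
  move=> [t s]; rewrite /inv /=; congr (_, _).
    apply/ffunP => i; rewrite !ffunE; case: eqP => [->|//].
    by rewrite /=.
  by rewrite ffunE eqxx.
have -> : #|J|%:R * (\sum_t F t) = \sum_t \sum_s F (ffun_set t a s).
  rewrite pair_big /=.
  rewrite (reindex_inj (inv_inj invK)) /=.
  have E : forall p : {ffun I -> J} * J,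
     F (ffun_set (ffun_set p.1 a p.2) a (p.1 a)) = F p.1.
    by move=> p; have /= := congr1 fst (invK p) => ->.
  rewrite (eq_bigr _ (fun p _ => E p)) -(pair_big xpredT xpredT (fun t s => F t)) /=.
  rewrite mulr_sumr; apply: eq_bigr => t _.
  by rewrite sumr_const cardT mulr_natl -cardT.
apply: le_trans (ler_sum _ (fun t _ => Hc t)) _.
by rewrite sumr_const cardT mulr_natr -cardT.
Qed.

Lemma sum_le_diameter (R : archiRealFieldType) (M : nat) (P : pred 'I_M) (c : R) :
  0 <= c ->
  (forall i j, P i -> P j -> `|(i%:R : R) - j%:R| <= c) ->
  \sum_(i < M) (P i)%:R <= c + 1.
Proof.
move=> c0 Hc.
have [i0 Pi0|P0] := pickP P; last first.
  by rewrite big1 ?addr_ge0 // => i _; rewrite P0.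
have [m Pm minm] := @arg_minnP _ i0 P (@nat_of_ord M) Pi0.
pose D := Num.truncn c.
have HD j : P j -> (j - m <= D)%N.
  move=> Pj; rewrite truncn_ge_nat // natrB ?minm //.
  by apply: le_trans (ler_norm _) _; exact: Hc.
have : (#|P| <= D.+1)%N.
  rewrite -[D.+1]card_ord; apply: (@leq_card_in _ _ (fun j : 'I_M => inord (j - m))).
  move=> i j Pi Pj /(congr1 val); rewrite /= !inordK ?ltnS ?HD // => e.
  by apply: val_inj; rewrite /= -(subnK (minm _ Pi)) -(subnK (minm _ Pj)) e.
rewrite -(ler_nat R) -natr1 => cardP.
rewrite (eq_bigr (fun i => if P i then 1 else 0)); last by move=> i _; case: (P i).
rewrite -big_mkcond sumr_const (le_trans cardP) // lerD2r.
by rewrite truncn_le.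
Qed.

End finite_counting.

(** * Averages over words *)

Lemma ler_bool (R : numDomainType) (b c : bool) : (b -> c) -> b%:R <= c%:R :> R.
Proof. by case: b c => [] [] // /(_ isT). Qed.

Lemma ler_bool0 (R : numDomainType) (b : bool) : ~ b -> b%:R <= 0 :> R.
Proof. by case: b => // /(_ isT). Qed.

Section word_average.
Variables (R : numFieldType) (N : nat).
Local Notation letter := 'I_N.+1.
Implicit Types (Phi Psi : seq letter -> R).

Fixpoint avg n Phi : R :=
  if n is m.+1 then N.+1%:R^-1 * \sum_i avg m (fun w => Phi (i :: w))
  else Phi [::].

Lemma invN_ge0 : 0 <= (N.+1%:R : R)^-1.
Proof. by rewrite invr_ge0. Qed.

Lemma sum_letters (c : R) : \sum_(i < N.+1) c = N.+1%:R * c.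
Proof. by rewrite sumr_const card_ord mulr_natl. Qed.

Lemma avg_const n (c : R) : avg n (fun=> c) = c.
Proof.
elim: n => //= n ->; rewrite sum_letters mulrA.
by rewrite mulVf ?mul1r // pnatr_eq0.
Qed.

Lemma ler_avg n Phi Psi :
  (forall w, size w = n -> Phi w <= Psi w) -> avg n Phi <= avg n Psi.
Proof.
elim: n Phi Psi => [|n IHn] Phi Psi le_; first exact: le_.
rewrite ler_wpM2l ?invN_ge0 // ler_sum // => i _; apply: IHn => w sw.
by apply: le_; rewrite /= sw.
Qed.

Lemma eq_avg n Phi Psi :
  (forall w, size w = n -> Phi w = Psi w) -> avg n Phi = avg n Psi.
Proof. by move=> e; apply/eqP; rewrite eq_le !ler_avg // => w /e ->. Qed.

Lemma avg_ge0 n Phi : (forall w, size w = n -> 0 <= Phi w) -> 0 <= avg n Phi.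
Proof. by move=> p; rewrite -(avg_const n 0); exact: ler_avg. Qed.

Lemma avgZ n c Phi : avg n (fun w => c * Phi w) = c * avg n Phi.
Proof.
elim: n Phi => //= n IHn Phi; rewrite mulrCA; congr (_ * _).
by rewrite mulr_sumr; apply: eq_bigr => i _; rewrite IHn.
Qed.

Lemma avg_sum n (I : Type) (r : seq I) (P : pred I) (F : I -> seq letter -> R) :
  avg n (fun w => \sum_(i <- r | P i) F i w) = \sum_(i <- r | P i) avg n (F i).
Proof.
elim: n F => //= n IHn F; rewrite (eq_bigr _ (fun i _ => IHn _)) exchange_big /=.
by rewrite mulr_sumr.
Qed.

Lemma avgD n Phi Psi : avg n (fun w => Phi w + Psi w) = avg n Phi + avg n Psi.
Proof.
have := avg_sum n [:: Phi; Psi] xpredT (fun F w => F w).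
rewrite !big_cons big_nil addr0 => <-; apply: eq_avg => w _.
by rewrite !big_cons big_nil addr0.
Qed.

End word_average.

(** * Translates of a contraction, and their transversality *)

Section projected_system.
Variables (R : realType) (N : nat) (H : R -> R) (k : R) (x0 : R).
Local Notation letter := 'I_N.+1.
Implicit Types (theta : letter -> R) (w v : seq letter) (rho : R).

Definition branch (th x : R) := th + H (x - th).
Definition word_map theta w x := foldr (fun i => branch (theta i)) x w.

Hypothesis k_gt0 : 0 < k.
Hypothesis k_small : k <= 20^-1.
Hypothesis Nk : 2 <= k * N.+1%:R.
Hypothesis H_slope : forall a b : R, a <= b -> k * (b - a) <= H b - H a <= 2 * k * (b - a).

Lemma H_dist a b : k * `|a - b| <= `|H a - H b| <= 2 * k * `|a - b|.
Proof.
wlog ab : a b / a <= b.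
  by move=> wl; case/orP: (le_total a b) => [/wl //|/wl]; rewrite distrC (distrC (H a)).
have d0 : 0 <= b - a by rewrite subr_ge0.
have /andP[lo hi] := H_slope ab.
rewrite distrC (ger0_norm d0) (distrC (H a)) ger0_norm ?lo //.
by rewrite (le_trans _ lo) // mulr_ge0 // ltW.
Qed.

Lemma branch_dist th x y : k * `|x - y| <= `|branch th x - branch th y| <= 2 * k * `|x - y|.
Proof.
have := H_dist (x - th) (y - th); rewrite /branch.
rewrite (_ : x - th - (y - th) = x - y); last by ring.
by rewrite (_ : th + H (x - th) - (th + H (y - th)) = H (x - th) - H (y - th)); last by ring.
Qed.

Lemma word_map_contraction theta w x y :
  `|word_map theta w x - word_map theta w y| <= (2 * k) ^+ size w * `|x - y|.
Proof.
elim: w => [|i w IHw] /=; first by rewrite expr0 mul1r.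
have /andP[_ h] := branch_dist (theta i) (word_map theta w x) (word_map theta w y).
by apply: le_trans h _; rewrite exprS -(mulrA (2 * k)) ler_wpM2l // mulr_ge0 // ltW.
Qed.

Lemma branch_param_dist th th' x y :
  `|branch th x - branch th' y| <= `|th - th'| + 2 * k * (`|x - y| + `|th - th'|).
Proof.
have /andP[_ h] := H_dist (x - th) (y - th').
rewrite /branch (_ : th + H (x - th) - (th' + H (y - th')) =
  (th - th') + (H (x - th) - H (y - th'))); last by ring.
apply: le_trans (ler_normD _ _) _; rewrite lerD2l; apply: le_trans h _.
rewrite ler_wpM2l ?mulr_ge0 ?(ltW k_gt0) //.
rewrite (_ : x - th - (y - th') = (x - y) - (th - th')); last by ring.
exact: ler_normB.
Qed.

(** The largest displacement D of the points of the words satisfies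
D <= d + 2k (D + d), whence the factor (1 + 2k) / (1 - 2k) <= 2. *)
Lemma word_map_param theta theta' d w x : 0 <= d ->
  (forall i, `|theta i - theta' i| <= d) ->
  `|word_map theta w x - word_map theta' w x| <= 2 * d.
Proof.
move=> d0 Hd; elim: w => [|i w IHw] /=; first by rewrite subrr normr0 mulr_ge0.
apply: le_trans (branch_param_dist _ _ _ _) _.
have := Hd i; move: IHw.
set X := `|_ - _|; set Y := `|_ - _| => IHw Yd.
have : 2 * k * (X + Y) <= 2 * k * (2 * d + d).
  by rewrite ler_wpM2l ?mulr_ge0 ?(ltW k_gt0) // lerD.
have : k * d <= 20^-1 * d by rewrite ler_wpM2r.
lra.
Qed.

(** The first letter a contributes the full displacement of its parameter,
whereas every other occurrence of a is seen through H and contributes at most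
2k times a bounded multiple of it: 6k in the first word and 4k in the second
one, altogether at most one half as k <= 1/20. *)
Lemma transversality theta theta' (a b : letter) (u v : seq letter) x :
  b != a -> (forall i, i != a -> theta i = theta' i) ->
  `|theta a - theta' a| <=
  2 * `|(word_map theta (a :: u) x - word_map theta (b :: v) x) -
        (word_map theta' (a :: u) x - word_map theta' (b :: v) x)|.
Proof.
move=> ba eq_off; set d := `|_|.
have d0 : 0 <= d by rewrite /d.
have Hd i : `|theta i - theta' i| <= d.
  by case: (eqVneq i a) => [->//|/eq_off ->]; rewrite subrr normr0.
have Pu := word_map_param u x d0 Hd; have Pv := word_map_param v x d0 Hd.
rewrite /= -!/(word_map _ _ _); move: Pu Pv.
set xu := word_map theta u x; set xu' := word_map theta' u x.
set xv := word_map theta v x; set xv' := word_map theta' v x => Pu Pv.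
have /andP[_ h1] := branch_dist (theta b) xv xv'.
rewrite -(eq_off _ ba).
have /andP[_ h2] := H_dist (xu - theta a) (xu' - theta' a).
have h3 : `|xu - theta a - (xu' - theta' a)| <= 2 * d + d.
  rewrite (_ : xu - theta a - (xu' - theta' a) = (xu - xu') - (theta a - theta' a)); last by ring.
  by apply: le_trans (ler_normB _ _) _; rewrite lerD.
set E := branch (theta a) xu - branch (theta b) xv
   - (branch (theta' a) xu' - branch (theta b) xv').
have dE : d <= `|E| + `|H (xu - theta a) - H (xu' - theta' a)|
   + `|branch (theta b) xv - branch (theta b) xv'|.
  rewrite /d (_ : theta a - theta' a = E - (H (xu - theta a) - H (xu' - theta' a))
     + (branch (theta b) xv - branch (theta b) xv')); last by rewrite /E /branch; ring.
  by apply: le_trans (ler_normD _ _) _; rewrite lerD2r; exact: ler_normB.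
have h4 : 2 * k * `|xu - theta a - (xu' - theta' a)| <= 2 * k * (3 * d).
  by rewrite ler_wpM2l ?mulr_ge0 ?(ltW k_gt0) //; lra.
have h5 : 2 * k * `|xv - xv'| <= 2 * k * (2 * d).
  by rewrite ler_wpM2l ?mulr_ge0 ?(ltW k_gt0).
have : k * d <= 20^-1 * d by rewrite ler_wpM2r.
lra.
Qed.

Definition is_near theta rho w v : bool :=
  `|word_map theta w x0 - word_map theta v x0| < rho.

Definition near_mass theta n rho w : R :=
  avg n (fun v => (is_near theta rho w v)%:R).

Definition near_pairs theta n rho : R := avg n (near_mass theta n rho).

(** Pairs with the same first letter are images of pairs of shorter words under
a map that multiplies distances by at least k. *)
Lemma near_pairs_rec theta n rho :
  near_pairs theta n.+1 rho <=
  N.+1%:R^-1 * near_pairs theta n (rho / k) +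
  N.+1%:R^-1 * (N.+1%:R^-1 * \sum_i \sum_(j | j != i)
    avg n (fun w => avg n (fun v => (is_near theta rho (i :: w) (j :: v))%:R))).
Proof.
rewrite /near_pairs /near_mass /= -mulrDr ler_wpM2l ?invN_ge0 //.
under eq_bigr do rewrite avgZ avg_sum.
have -> : avg n (fun w => avg n (fun v => (is_near theta (rho / k) w v)%:R))
  = N.+1%:R^-1 * \sum_(i < N.+1)
      avg n (fun w => avg n (fun v => (is_near theta (rho / k) w v)%:R)) :> R.
  by rewrite sum_letters mulrA mulVf ?mul1r // pnatr_eq0.
rewrite -mulr_sumr -mulrDr ler_wpM2l ?invN_ge0 // -big_split /= ler_sum // => i _.
rewrite (bigD1 i) //= lerD2r; apply: ler_avg => w _; apply: ler_avg => v _.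
apply: ler_bool; rewrite /is_near /= => near_iwv.
have /andP[h _] := branch_dist (theta i) (word_map theta w x0) (word_map theta v x0).
by rewrite ltr_pdivlMr // mulrC; apply: le_lt_trans h near_iwv.
Qed.

Section parameter_grid.
Variables (beta : letter -> R) (wd : R) (M : nat).
Hypothesis wd_gt0 : 0 < wd.
Local Notation grid := {ffun letter -> 'I_M.+1}.

Definition grid_param (t : grid) (i : letter) : R :=
  beta i + (t i)%:R * (wd / M.+1%:R).

Lemma grid_param_itv t i : beta i <= grid_param t i <= beta i + wd.
Proof.
rewrite /grid_param lerDl lerD2l mulr_ge0 ?divr_ge0 ?(ltW wd_gt0) //=.
rewrite mulrA ler_pdivrMr ?ltr0n // mulrC ler_wpM2l ?(ltW wd_gt0) // ler_nat.
exact: ltnW.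
Qed.

(** Along a line of the grid in direction a, the parameters that make the two
words rho-close lie within 4 rho of each other, by transversality. *)
Lemma sum_grid_near rho a b u v : b != a -> wd / M.+1%:R <= rho ->
  \sum_(t : grid) (is_near (grid_param t) rho (a :: u) (b :: v))%:R
  <= 5 / wd * rho * #|{: grid}|%:R :> R.
Proof.
move=> ba; set h := wd / _ => h_rho.
have M0 : 0 < M.+1%:R :> R by rewrite ltr0n.
have h0 : 0 < h by rewrite divr_gt0.
have rho0 : 0 < rho by exact: lt_le_trans h_rho.
rewrite -(ler_pM2l M0) -[in X in X * _](card_ord M.+1).
have -> : M.+1%:R * (5 / wd * rho * #|{: grid}|%:R) = 5 * rho / h * #|{: grid}|%:R.
  by rewrite /h; field; rewrite ?gt_eqF.
apply: (@sum_ffun_slices _ _ _ _ a) => t.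
apply: le_trans (@sum_le_diameter R M.+1 _ (4 * rho / h) _ _) _.
- by rewrite divr_ge0 ?mulr_ge0 // ltW.
- move=> i j near_i near_j.
  have off c : c != a -> grid_param (ffun_set t a i) c = grid_param (ffun_set t a j) c.
    by move=> /negbTE ca; rewrite /grid_param !ffunE ca.
  have := transversality u v x0 ba off.
  rewrite {1 2}/grid_param !ffunE eqxx -/h.
  rewrite (_ : beta a + _ - _ = (i%:R - j%:R) * h); last by ring.
  rewrite normrM (gtr0_norm h0) ler_pdivlMr // => /le_trans; apply.
  move: near_i near_j; rewrite /is_near.
  set X := _ - _; set Y := _ - _ => Xr Yr.
  by have := ler_normB X Y; lra.
- have : 1 <= rho / h by rewrite ler_pdivlMr // mul1r.
  lra.
Qed.

(** By induction on n: pairs with the same first letter, a proportion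
1/(N+1) of all pairs, are controlled at the scale rho / k by the previous
step, which costs a factor 1/(k (N+1)) <= 1/2, and the other pairs contribute
5 rho / wd by transversality. *)
Lemma sum_grid_near_pairs n rho : wd / M.+1%:R <= rho ->
  \sum_(t : grid) near_pairs (grid_param t) n rho
  <= (N.+1%:R ^- n + 10 / wd * rho) * #|{: grid}|%:R.
Proof.
have h0 : 0 < wd / M.+1%:R by rewrite divr_gt0 // ltr0n.
have N0 : 0 < N.+1%:R :> R by rewrite ltr0n.
elim: n rho => [|n IHn] rho h_rho.
  have rho0 : 0 < rho by exact: lt_le_trans h_rho.
  have C0 : 0 <= 10 / wd * rho by rewrite mulr_ge0 ?divr_ge0 ?(ltW wd_gt0) ?(ltW rho0).
  have le1 (t : grid) : near_pairs (grid_param t) 0 rho <= 1.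
    by rewrite /near_pairs /near_mass /= lern1 leq_b1.
  apply: le_trans (ler_sum _ (fun t _ => le1 t)) _.
  by rewrite sumr_const cardT -cardT expr0 invr1 mulrDl mul1r lerDl mulr_ge0.
have rho0 : 0 < rho by exact: lt_le_trans h_rho.
set L := #|{: grid}|%:R; have L0 : 0 <= L :> R by rewrite ler0n.
have rho_k : rho <= rho / k.
  by rewrite ler_pdivlMr // ler_piMr ?(ltW rho0) //; move: k_small; lra.
have := IHn _ (le_trans h_rho rho_k).
set S := \sum_t _ => IHS.
apply: le_trans (ler_sum _ (fun t _ => near_pairs_rec _ _ _)) _.
rewrite big_split /= -!mulr_sumr.
have off : \sum_(t : grid) \sum_i \sum_(j | j != i) avg n (fun w => avg n (fun v =>
    (is_near (grid_param t) rho (i :: w) (j :: v))%:R))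
  <= N.+1%:R * (N.+1%:R * (5 / wd * rho * L)).
  rewrite exchange_big /=.
  rewrite -sum_letters; apply: ler_sum => i _; rewrite exchange_big /= -sum_letters.
  have c0 : 0 <= 5 / wd * rho * L by rewrite !mulr_ge0 ?invr_ge0 ?(ltW wd_gt0) ?(ltW rho0).
  rewrite [X in X <= _]big_mkcond; apply: ler_sum => j _; case: ifP => // ji.
  rewrite -avg_sum -[X in _ <= X](@avg_const _ N n); apply: ler_avg => w _.
  rewrite -avg_sum -[X in _ <= X](@avg_const _ N n); apply: ler_avg => v _.
  exact: sum_grid_near.
have : N.+1%:R^-1 * S <= N.+1%:R^-1 * ((N.+1%:R ^- n + 10 / wd * (rho / k)) * L).
  by rewrite ler_wpM2l ?invN_ge0.
have : N.+1%:R^-1 * (N.+1%:R^-1 * (\sum_(t : grid) \sum_i \sum_(j | j != i) avg n (fun w => avg n (fun v =>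
    (is_near (grid_param t) rho (i :: w) (j :: v))%:R)))) <= 5 / wd * rho * L.
  by rewrite !ler_pdivrMl.
rewrite exprS invfM; set a := N.+1%:R^-1; set Nn := N.+1%:R ^- n.
set T := a * (a * _) => h1 h2.
suff : a * (10 / wd * (rho / k)) * L <= 5 / wd * rho * L.
  move: h1 h2; rewrite (_ : a * ((Nn + 10 / wd * (rho / k)) * L)
    = a * Nn * L + a * (10 / wd * (rho / k)) * L); last by ring.
  have -> : (a * Nn + 10 / wd * rho) * L = a * Nn * L + 2 * (5 / wd * rho * L).
    by field; rewrite gt_eqF.
  by rewrite -/S; lra.
rewrite ler_wpM2r //.
rewrite (_ : a * (10 / wd * (rho / k)) = (5 / wd * rho) * (2 / (k * N.+1%:R))).
  rewrite ler_piMr ?mulr_ge0 ?invr_ge0 ?(ltW wd_gt0) ?(ltW rho0) //.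
  by rewrite ler_pdivrMr ?mulr_gt0 // mul1r.
by rewrite /a; field; rewrite !gt_eqF.
Qed.

Lemma exists_grid_near_pairs n rho : wd / M.+1%:R <= rho ->
  exists t : grid, near_pairs (grid_param t) n rho <= N.+1%:R ^- n + 10 / wd * rho.
Proof.
move=> /(sum_grid_near_pairs n) sum_le; apply: contrapT => no_t.
move: sum_le; apply/negP; rewrite -ltNge.
rewrite mulr_natr -sumr_const.
apply: ltr_sum => [|t _].
  by apply/hasP; exists [ffun=> ord0]; rewrite ?mem_index_enum.
by rewrite ltNge; apply/negP => ?; apply: no_t; exists t.
Qed.

End parameter_grid.

Lemma exists_near_pairs_le (beta : letter -> R) (wd : R) n : 0 < wd ->
  exists2 theta, forall i, beta i <= theta i <= beta i + wd
  & near_pairs theta n (N.+1%:R ^- n) <= (1 + 10 / wd) * N.+1%:R ^- n.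
Proof.
move=> wd_gt0; set rho := N.+1%:R ^- n.
have rho0 : 0 < rho by rewrite invr_gt0 exprn_gt0.
have h_rho : wd / (Num.bound (wd / rho)).+1%:R <= rho.
  rewrite ler_pdivrMr ?ltr0n // mulrC -ler_pdivrMr //.
  have q0 : 0 <= wd / rho by rewrite divr_ge0 // ltW.
  by apply: le_trans (ltW (archi_boundP q0)) _; rewrite ler_nat.
have [t Ht] := exists_grid_near_pairs beta wd_gt0 n h_rho.
exists (grid_param beta wd t); first by move=> i; exact: grid_param_itv.
by apply: le_trans Ht _; rewrite [leRHS]mulrDl mul1r.
Qed.

Definition in_itv_cc (x : R) (I : R * R) : bool := (I.1 <= x) && (x <= I.2).

(** If a word in the slice sees at most a mass c at distance less than rho, then
the slice, which lies within that distance of it, has mass at most c. *)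
Lemma avg_slice_le theta n rho c a :
  avg n (fun w => ((a <= word_map theta w x0 < a + rho) &&
                   (near_mass theta n rho w <= c))%:R) <= Num.max c 0.
Proof.
pose good w := (a <= word_map theta w x0 < a + rho) && (near_mass theta n rho w <= c).
have [[w [sw gw]]|none] := pselect (exists w, size w = n /\ good w).
  rewrite le_max; apply/orP; left.
  have /andP[/andP[aw wa] mass_c] := gw; apply: le_trans mass_c.
  apply: ler_avg => v _; apply: ler_bool => /andP[/andP[av va] _].
  by rewrite /is_near ltr_norml; apply/andP; split; lra.
rewrite le_max; apply/orP; right; rewrite -[X in _ <= X](avg_const N n).
apply: ler_avg => w sw; rewrite -/(good w).
by case: (boolP (good w)) => // gw; case: none; exists w.
Qed.

Lemma avg_itv_le theta n rho c a m : 0 <= c ->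
  avg n (fun w => ((a <= word_map theta w x0 < a + m%:R * rho) &&
                   (near_mass theta n rho w <= c))%:R) <= m%:R * c.
Proof.
move=> c0; elim: m a => [|m IHm] a.
  rewrite [leRHS]mul0r -[X in _ <= X](avg_const N n); apply: ler_avg => w _.
  apply: ler_bool0 => /andP[/andP[h1 h2] _].
  by move: h2; rewrite mul0r addr0 ltNge h1.
have := lerD (avg_slice_le theta n rho c a) (IHm (a + rho)).
rewrite max_l // -avgD => cover.
have -> : m.+1%:R * c = c + m%:R * c by rewrite -natr1 mulrDl mul1r addrC.
apply: le_trans cover; apply: ler_avg => w _.
set x := word_map _ _ _; case: (_ <= c); rewrite ?andbF ?andbT ?addr0 //.
have [x1|x1] := ltP x (a + rho); rewrite ?andbT ?andbF /= ?add0r ?andTb.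
  by apply: ler_wpDr; [exact: ler0n|apply: ler_bool => /andP[]].
by apply: ler_bool => /andP[_ x2]; rewrite -natr1 mulrDl mul1r in x2; lra.
Qed.

Lemma near_mass_markov theta n rho (c : R) : 0 < c ->
  avg n (fun w => (c < near_mass theta n rho w)%R%:R) <= near_pairs theta n rho / c.
Proof.
move=> c0; rewrite ler_pdivlMr // mulrC -avgZ; apply: ler_avg => w _.
case: ltP => [/ltW|_]; first by rewrite mulr1.
by rewrite mulr0; apply: avg_ge0.
Qed.

(** The words whose close neighbours have a mass larger than S rho have
proportion at most C / S by the Markov inequality, and the others are counted
slice by slice. *)
Lemma avg_itvs_le theta n rho (C S : R) (s : seq (R * R)) :
  0 < rho -> 0 < S -> near_pairs theta n rho <= C * rho ->
  (forall I, I \in s -> I.1 <= I.2) ->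
  avg n (fun w => (has (in_itv_cc (word_map theta w x0)) s)%:R)
  <= S * (\sum_(I <- s) (I.2 - I.1 + rho)) + C / S.
Proof.
move=> rho0 S0 pairs_le; have c0 : 0 < S * rho by rewrite mulr_gt0.
have markov : avg n (fun w => (S * rho < near_mass theta n rho w)%R%:R) <= C / S.
  apply: le_trans (near_mass_markov _ _ _ c0) _.
  rewrite ler_pdivrMr // (_ : C / S * (S * rho) = C * rho) //.
  by field; rewrite gt_eqF.
move=> s_itv; pose light w := near_mass theta n rho w <= S * rho.
pose hit s w := has (in_itv_cc (word_map theta w x0)) s.
have light_le : avg n (fun w => (hit s w && light w)%:R)
    <= S * (\sum_(I <- s) (I.2 - I.1 + rho)).
  elim: s s_itv => [|I s IHs] s_itv.
    by rewrite big_nil mulr0 -[X in _ <= X](avg_const N n); apply: ler_avg => w _.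
  rewrite big_cons mulrDr.
  have {}IHs := IHs (fun J Js => s_itv J (mem_behead (s := I :: s) Js)).
  have I12 := s_itv I (mem_head _ _).
  pose m := (Num.truncn ((I.2 - I.1) / rho)).+1.
  have q0 : 0 <= (I.2 - I.1) / rho by rewrite divr_ge0 ?subr_ge0 // ltW.
  have /andP[m_le lt_m] := truncn_itv q0.
  have hI := avg_itv_le theta n rho I.1 m (ltW c0).
  have {}hI := le_trans hI (_ : _ <= S * (I.2 - I.1 + rho)).
  have mS : m%:R * (S * rho) <= S * (I.2 - I.1 + rho).
    rewrite mulrCA ler_wpM2l ?(ltW S0) // -natr1 mulrDl mul1r lerD2r.
    by rewrite -ler_pdivlMr.
  apply: le_trans (lerD (hI mS) IHs); rewrite -avgD; apply: ler_avg => w _.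
  rewrite /light /hit /=; case: (near_mass _ _ _ _ <= _); rewrite ?andbF ?andbT ?addr0 //.
  case: (boolP (in_itv_cc _ _)) => [/andP[x1 x2]|_] /=; last by rewrite lerDr.
  have x3 : word_map theta w x0 < I.1 + m%:R * rho.
    by apply: le_lt_trans x2 _; rewrite -ltrBlDl -ltr_pdivrMr.
  by rewrite x1 x3 /= lerDl.
apply: le_trans (lerD light_le markov); rewrite -avgD; apply: ler_avg => w _.
rewrite /light /hit ltNge; case: (has _ _); rewrite ?addr_ge0 //=.
by case: (_ <= S * rho); rewrite /= ?addr0 ?add0r.
Qed.

End projected_system.

(** * Choice of the parameter *)

Section compactness.
Variables (R : realType) (N : nat) (H : R -> R) (k : R) (x0 : R).
Local Notation letter := 'I_N.+1.
Hypothesis k_gt0 : 0 < k.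
Hypothesis k_small : k <= 20^-1.
Hypothesis Nk : 2 <= k * N.+1%:R.
Hypothesis H_slope : forall a b : R, a <= b -> k * (b - a) <= H b - H a <= 2 * k * (b - a).

(** A cluster point of good parameters for longer and longer words.  What
survives in the limit is that theta is approximated by parameters that are
good at arbitrarily small scales; this suffices to estimate the mass of
intervals, whose sizes are independent of the scale. *)
Lemma exists_limit_near_pairs (beta : letter -> R) (wd : R) : 0 < wd ->
  exists2 theta, forall i, beta i <= theta i <= beta i + wd &
  forall (e : R) n0, 0 < e -> exists n theta', [/\ (n0 <= n)%N,
    forall i, `|theta i - theta' i| < e &
    near_pairs H x0 theta' n (N.+1%:R ^- n) <= (1 + 10 / wd) * N.+1%:R ^- n].
Proof.
move=> wd0.
have /choice[th Hth] : forall n, exists theta, (forall i, beta i <= theta i <= beta i + wd) /\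
    near_pairs H x0 theta n (N.+1%:R ^- n) <= (1 + 10 / wd) * N.+1%:R ^- n.
  move=> n; have [theta h1 h2] := exists_near_pairs_le x0 k_gt0 k_small Nk H_slope beta n wd0.
  by exists theta.
pose u n : 'rV[R]_N.+1 := \row_i th n i.
pose box := [set v : 'rV[R]_N.+1 | forall i, `[beta i, beta i + wd]%classic (v ord0 i)].
have cbox : compact box.
  by apply: (@rV_compact _ _ (fun i => `[beta i, beta i + wd]%classic)) => i; exact: segment_compact.
have ubox : (u @ \oo) box.
  exists 0%N => // n _ i; rewrite /u mxE /= in_itv /=; exact: (Hth n).1.
have [p [boxp clp]] := cbox _ _ ubox.
exists (fun i => p ord0 i) => [i|e n0 e0].
  by have := boxp i; rewrite /= in_itv.
have Fn : (u @ \oo) (u @` [set n | (n0 <= n)%N]).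
  by exists n0 => // n /= n0n; exists n.
have Bp : nbhs p [set v | forall i, `|p ord0 i - v ord0 i| < e].
  apply/nbhs_ballP; exists e => // v pv i.
  exact: (pv.2 ord0 i).
have [_ [[n n0n <-] /= near_p]] := clp _ _ Fn Bp.
exists n, (th n); split => // [i|]; last exact: (Hth n).2.
by have := near_p i; rewrite mxE.
Qed.

End compactness.

(** * Self-similar measures on the line: absolute continuity and uniqueness *)

Section null_sets.
Variable R : realType.

Lemma lebesgue_null_cover (A : set R) (d : R) : 0 < d ->
  lebesgue_measure (A : set (measurableTypeR R)) = 0%E ->
  exists I : nat -> R * R, [/\ forall i, (I i).1 <= (I i).2,
    A `<=` \bigcup_i `](I i).1, (I i).2]%classic &
    forall m, \sum_(i < m) ((I i).2 - (I i).1) <= d].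
Proof.
move=> d0 A0.
have : (lebesgue_measure (A : set (measurableTypeR R)) < d%:E)%E by rewrite A0 lte_fin.
move=> /ereal_inf_lt[_ /= [F [mF AF] <-] sum_lt].
have /choice[I HI] : forall i, exists p : R * R, p.1 <= p.2 /\ F i = `]p.1, p.2]%classic.
  move=> i; have /ocitvP[->|[p p12 ->]] := mF i.
    by exists (0, 0); split; rewrite ?lexx //= set_itv_ge // bnd_simp ltxx.
  by exists p; split => //; exact: ltW.
exists I; split=> [i|x /AF[i _ Fx]|m]; first by case: (HI i).
  by exists i => //; case: (HI i) => _ <-.
rewrite -lee_fin; apply: le_trans (ltW sum_lt).
rewrite -sumEFin -(big_mkord xpredT (fun i => ((I i).2 - (I i).1)%:E)).
have -> : (\sum_(0 <= i < m) ((I i).2 - (I i).1)%:E = \sum_(0 <= i < m) wlength idfun (F i))%E.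
  by apply: eq_bigr => i _; have [h ->] := HI i; rewrite wlength_itv_bnd.
by apply: nneseries_lim_ge => // i _ _; exact: wlength_ge0.
Qed.

End null_sets.

Section self_similar.
Variables (R : realType) (N : nat) (H : R -> R) (k : R).
Local Notation letter := 'I_N.+1.
Implicit Types (nu : probability (measurableTypeR R) R) (theta : letter -> R).
Implicit Types (A : set (measurableTypeR R)).

Definition self_similar theta nu := forall A, measurable A ->
  nu A = ((N.+1%:R^-1)%:E * \sum_(i < N.+1) nu (branch H (theta i) @^-1` A))%E.

Hypothesis k_gt0 : 0 < k.
Hypothesis k_small : k <= 20^-1.
Hypothesis H_slope : forall a b : R, a <= b -> k * (b - a) <= H b - H a <= 2 * k * (b - a).

Lemma continuous_branch th : continuous (branch H th).
Proof.
move=> x; apply/cvgrPdist_le => e e0; near=> y.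
have /andP[_ h] := branch_dist k_gt0 H_slope th x y; apply: le_trans h _.
have : 2 * k * `|x - y| <= 1 * `|x - y| by rewrite ler_wpM2r //; move: k_small; lra.
rewrite mul1r => /le_trans; apply.
by near: y; apply: (@cvgr_dist_le _ _ _ (nbhs x) _ id x); first exact: cvg_id.
Unshelve. all: by end_near. Qed.

Lemma measurable_branch th A : measurable A -> measurable (branch H th @^-1` A).
Proof.
move=> mA; rewrite -[X in measurable X]setTI.
exact: (continuous_measurable_fun (@continuous_branch th)).
Qed.

Lemma fine_self_similar theta nu n A : self_similar theta nu -> measurable A ->
  fine (nu A) = avg n (fun w => fine (nu (word_map H theta w @^-1` A))).
Proof.
move=> ss; elim: n A => [//|n IHn] A mA /=.
rewrite ss // fineM ?fin_numM //=; last first.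
  by apply/sum_fin_numP => i _ _; apply: fin_num_measure; exact: measurable_branch.
congr (_ * _); rewrite -sum_fine; last by move=> i _; apply: fin_num_measure; exact: measurable_branch.
by apply: eq_bigr => i _; rewrite IHn //; exact: measurable_branch.
Qed.

Lemma measurable_word_map theta w A : measurable A -> measurable (word_map H theta w @^-1` A).
Proof.
elim: w A => [|i w IHw] A mA //.
by have := IHw _ (measurable_branch (theta i) mA).
Qed.

Lemma fine_prob_le_bool nu (J A : set (measurableTypeR R)) (b : bool) : measurable A ->
  measurable J -> nu J = 1%E -> (forall x, J x -> A x -> b) -> fine (nu A) <= b%:R.
Proof.
move=> mA mJ J1 Ab; case: b Ab => [_|Ab].
  by rewrite -lee_fin fineK ?fin_num_measure // probability_le1.
rewrite [leRHS](_ : _ = fine (nu (~` J))); last first.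
  by rewrite probability_setC // J1 subee.
rewrite fine_le ?fin_num_measure //; first exact: measurableC.
apply: le_measure; rewrite ?inE //; first exact: measurableC.
by move=> x Ax Jx; have := Ab _ Jx Ax.
Qed.

End self_similar.

Section absolute_continuity.
Variables (R : realType) (N : nat) (H : R -> R) (k : R).
Local Notation letter := 'I_N.+1.
Implicit Types (nu : probability (measurableTypeR R) R) (theta : letter -> R).
Hypothesis k_gt0 : 0 < k.
Hypothesis k_small : k <= 20^-1.
Hypothesis Nk : 2 <= k * N.+1%:R.
Hypothesis H_slope : forall a b : R, a <= b -> k * (b - a) <= H b - H a <= 2 * k * (b - a).

Lemma geometric_le (q c d : R) : 0 <= q < 1 -> 0 < d ->
  exists n0, forall n, (n0 <= n)%N -> q ^+ n * c <= d.
Proof.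
move=> /andP[q0 q1] d0.
have : (fun n => q ^+ n * c) @ \oo --> 0 * c.
  by apply: cvgMl; apply: cvg_expr; rewrite ger0_norm.
rewrite mul0r => /cvgr_le /(_ _ d0) [n0 _ Hn0].
by exists n0 => n; exact: Hn0.
Qed.

Variables (theta : letter -> R) (a0 b0 x0 C : R).
Hypothesis x0J : a0 <= x0 <= b0.
Hypothesis near_theta : forall (e : R) n0, 0 < e -> exists n theta', [/\ (n0 <= n)%N,
    forall i, `|theta i - theta' i| < e &
    near_pairs H x0 theta' n (N.+1%:R ^- n) <= C * N.+1%:R ^- n].

(** A self-similar measure is the mean over the words of length n of its images
under the word maps, and each of these lives in a tiny neighbourhood of the
point of the word; so its mass of a union of intervals is at most the
proportion of words whose point, for a nearby good parameter, falls in
slightly larger intervals. *)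
Lemma self_similar_itvs_le nu (S : R) (s : seq (R * R)) (U : set (measurableTypeR R)) :
  self_similar H theta nu -> nu `[a0, b0]%classic = 1%E -> 0 < S ->
  measurable U -> (forall x, U x -> has (in_itv_cc x) s) ->
  (forall I, I \in s -> I.1 <= I.2) ->
  fine (nu U) <= S * (\sum_(I <- s) (I.2 - I.1)) + C / S.
Proof.
move=> ss J1 S0 mU Us s_itv; apply/ler_addgt0Pr => e e0.
pose d := e / (7 * S * (size s).+1%:R).
have d0 : 0 < d by rewrite divr_gt0 // !mulr_gt0 // ltr0n.
have k2 : 0 <= 2 * k < 1 by apply/andP; split; move: k_small k_gt0; lra.
have N1 : 1 < N.+1%:R :> R.
  have N0 : 0 <= N.+1%:R :> R by [].
  have : k * N.+1%:R <= 20^-1 * N.+1%:R by rewrite ler_wpM2r.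
  by move: Nk; lra.
have iN : 0 <= (N.+1%:R^-1 : R) < 1 by rewrite invr_ge0 ler0n invf_lt1 // ltr0n.
have [n1 Hn1] := geometric_le (b0 - a0) k2 d0.
have [n2 Hn2] := geometric_le 1 iN d0.
have [n [th' [n12 th'_near pairs_le]]] := near_theta (maxn n1 n2) d0.
move: n12; rewrite geq_max => /andP[/Hn1 small1 /Hn2]; rewrite mulr1 exprVn => small2.
set rho := N.+1%:R ^- n in pairs_le small2.
have rho0 : 0 < rho by rewrite invr_gt0 exprn_gt0.
pose enlarge (I : R * R) := (I.1 - 3 * d, I.2 + 3 * d).
have enlarged_itv I : I \in map enlarge s -> I.1 <= I.2.
  by move=> /mapP[J Js ->] /=; have := s_itv _ Js; move: d0; lra.
have bound := avg_itvs_le rho0 S0 pairs_le enlarged_itv.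
rewrite (fine_self_similar k_gt0 k_small H_slope n ss mU).
apply: le_trans (le_trans _ bound) _.
  apply: ler_avg => w sw; apply: (fine_prob_le_bool _ _ J1) => //.
    exact: (measurable_word_map k_gt0 k_small H_slope).
  move=> y /=; rewrite in_itv /= => /andP[ay yb] /Us /hasP[I Is /andP[I1 I2]].
  apply/hasP; exists (enlarge I); first exact: map_f.
  have h1 := word_map_contraction k_gt0 H_slope theta w y x0.
  have h2 := word_map_param k_gt0 k_small H_slope w x0 (ltW d0) (fun i => ltW (th'_near i)).
  have h3 : (2 * k) ^+ size w * `|y - x0| <= d.
    rewrite sw; apply: le_trans small1; rewrite ler_wpM2l ?exprn_ge0 ?mulr_ge0 ?(ltW k_gt0) //.
    by rewrite ler_norml; move: x0J => /andP[] *; apply/andP; split; lra.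
  move: h1 h2 I1 I2; rewrite /in_itv_cc /= ler_norml.
  set x := word_map H theta w y; set x' := word_map H theta w x0.
  set x'' := word_map H th' w x0.
  move=> /andP[h1 h1'] /ler_normlP[h2 h2'] I1 I2.
  by apply/andP; split; lra.
rewrite big_map /= (addrAC _ _ e) lerD2r.
have -> : \sum_(I <- s) ((I.2 + 3 * d) - (I.1 - 3 * d) + rho)
    = \sum_(I <- s) (I.2 - I.1) + (size s)%:R * (6 * d + rho).
  rewrite (eq_bigr (fun I : R * R => (I.2 - I.1) + (6 * d + rho))); last by move=> I _; ring.
  by rewrite big_split /= big_const_seq count_predT iter_addr_0 [(size s)%:R * _]mulr_natl.
rewrite mulrDr lerD2l.
have sz : (size s)%:R <= (size s).+1%:R :> R by rewrite ler_nat.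
have ed : e = S * ((size s).+1%:R * (7 * d)).
  by rewrite /d; field; rewrite !gt_eqF ?ltr0n.
rewrite [leRHS]ed ler_wpM2l ?(ltW S0) //; apply: ler_pM => //.
  by move: d0 rho0; lra.
by move: small2; lra.
Qed.

(** A null set is covered by intervals of total length d, whence
nu A <= S d + C / S; take S large, then d small. *)
Lemma self_similar_null nu (A : set (measurableTypeR R)) : 0 <= C ->
  self_similar H theta nu -> nu `[a0, b0]%classic = 1%E ->
  measurable A -> lebesgue_measure A = 0%E -> nu A = 0%E.
Proof.
move=> C0 ss J1 mA A0; apply/eqP; rewrite -measure_le0.
apply/lee_addgt0Pr => e e0; rewrite add0e.
(* then C / S < e / 2 and S d = e / 2 *)
pose S := 2 * (C + 1) / e; pose d := e / 2 / S.
have S0 : 0 < S by rewrite divr_gt0 // mulr_gt0 // ltr_wpDl.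
have d0 : 0 < d by apply: divr_gt0 => //; exact: divr_gt0.
have [I [I12 AI sumI]] := lebesgue_null_cover d0 A0.
pose B i : set (measurableTypeR R) := `](I i).1, (I i).2]%classic.
pose V n : set (measurableTypeR R) := \big[setU/set0]_(i < n) B i.
have mB i : measurable (B i).
  exact: measurable_itv.
have mV n : measurable (V n) by apply: bigsetU_measurable.
apply: (@le_trans _ _ (nu (\bigcup_n V n))).
  apply: le_measure; rewrite ?inE //; first exact: bigcupT_measurable.
  by move=> x /AI[i _ Ix]; exists i.+1 => //; rewrite /V -bigcup_mkord; exists i => /=.
have cvgV : nu \o V @ \oo --> nu (\bigcup_n V n).
  apply: nondecreasing_cvg_mu => //; first exact: bigcupT_measurable.
  move=> m n mn; apply/subsetPset; rewrite /V -!bigcup_mkord => x [i /= im Bx].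
  by exists i => //=; exact: leq_trans mn.
rewrite -(cvg_lim _ cvgV) //; apply: lime_le; first by apply/cvg_ex; eexists; exact: cvgV.
apply: nearW => n /=; rewrite -[leLHS]fineK ?fin_num_measure // lee_fin.
pose s := [seq I i | i <- index_iota 0 n].
have Vs x : V n x -> has (in_itv_cc x) s.
  rewrite /V -bigcup_mkord => -[i /= i_n]; rewrite /B /= in_itv /= => /andP[x1 x2].
  apply/hasP; exists (I i); first by apply: map_f; rewrite mem_index_iota.
  by rewrite /in_itv_cc (ltW x1).
have s_itv J : J \in s -> J.1 <= J.2 by move=> /mapP[i _ ->].
apply: le_trans (self_similar_itvs_le ss J1 S0 (mV n) Vs s_itv) _.
rewrite big_map big_mkord.
have : S * (\sum_(i < n) ((I i).2 - (I i).1)) <= S * d by rewrite ler_wpM2l ?(ltW S0).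
have -> : S * d = e / 2 by rewrite /d; field; rewrite gt_eqF.
have : C / S <= e / 2.
  rewrite ler_pdivrMr // /S (_ : e / 2 * _ = C + 1); first by lra.
  by field; rewrite gt_eqF.
lra.
Qed.

End absolute_continuity.

Section uniqueness.
Variables (R : realType) (N : nat) (H : R -> R) (k : R).
Local Notation letter := 'I_N.+1.
Implicit Types (nu : probability (measurableTypeR R) R) (theta : letter -> R).
Hypothesis k_gt0 : 0 < k.
Hypothesis k_small : k <= 20^-1.
Hypothesis H_slope : forall a b : R, a <= b -> k * (b - a) <= H b - H a <= 2 * k * (b - a).

(** Both measures are within (2k)^n |J| of the distribution of the points of the
words of length n, so that their distribution functions are comparable up to
an arbitrarily small shift; right continuity removes the shift. *)
Lemma self_similar_ray_le theta a0 b0 nu nu' a : a0 <= b0 ->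
  self_similar H theta nu -> nu `[a0, b0]%classic = 1%E ->
  self_similar H theta nu' -> nu' `[a0, b0]%classic = 1%E ->
  (nu' `]-oo, a]%classic <= nu `]-oo, a]%classic)%E.
Proof.
move=> ab ss J1 ss' J1'.
have k2 : 0 <= 2 * k < 1 by apply/andP; split; move: k_small k_gt0; lra.
have shift e : 0 < e -> (nu' `]-oo, a]%classic <= nu `]-oo, (a + e)%R]%classic)%E.
  move=> e0; have e20 : 0 < e / 2 by rewrite divr_gt0.
  have [n /(_ n (leqnn _)) small] := geometric_le (b0 - a0) k2 e20.
  rewrite -[leLHS]fineK ?fin_num_measure // -[leRHS]fineK ?fin_num_measure // lee_fin.
  rewrite (fine_self_similar k_gt0 k_small H_slope n ss') //.
  rewrite (fine_self_similar k_gt0 k_small H_slope n ss) //.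
  have close w y z : size w = n -> a0 <= y <= b0 -> a0 <= z <= b0 ->
      word_map H theta w y <= word_map H theta w z + e / 2.
    move=> sw /andP[y1 y2] /andP[z1 z2].
    have h := word_map_contraction k_gt0 H_slope theta w y z.
    have : (2 * k) ^+ size w * `|y - z| <= e / 2.
      rewrite sw; apply: le_trans small; rewrite ler_wpM2l ?exprn_ge0 ?mulr_ge0 ?(ltW k_gt0) //.
      by rewrite ler_norml; apply/andP; split; lra.
    by move: h => /ler_normlP[_]; lra.
  pose b w := word_map H theta w a0 <= a + e / 2.
  apply: (@le_trans _ _ (avg n (fun w => (b w)%:R))).
    apply: ler_avg => w sw; apply: (fine_prob_le_bool _ _ J1') => //.
      exact: (measurable_word_map k_gt0 k_small H_slope).
    move=> y /=; rewrite !in_itv /= => Jy ya; rewrite /b.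
    by have := close w a0 y sw; rewrite lexx ab => /(_ isT Jy); lra.
  apply: ler_avg => w sw; case: (boolP (b w)) => [bw|_]; last first.
    by rewrite [leLHS]mulr0n fine_ge0.
  rewrite -lee_fin fineK ?fin_num_measure //; last first.
    exact: (measurable_word_map k_gt0 k_small H_slope).
  rewrite -J1; apply: le_measure; rewrite ?inE //.
    exact: (measurable_word_map k_gt0 k_small H_slope).
  move=> y /=; rewrite !in_itv /= => Jy.
  by have := close w y a0 sw Jy; rewrite lexx ab => /(_ isT); move: bw; rewrite /b; lra.
pose F n : set (measurableTypeR R) := `]-oo, (a + n.+1%:R^-1)%R]%classic.
have mF i : measurable (F i) by exact: measurable_itv.
have cvgF : nu \o F @ \oo --> nu `]-oo, a]%classic.
  rewrite (itvNycEbigcap false); apply: nonincreasing_cvg_mu => [| | |m n mn] //.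
  - by rewrite -ge0_fin_numE ?fin_num_measure.
  - by apply: bigcap_measurable.
  - by apply/subsetPset; apply: subset_itvl; rewrite bnd_simp lerD2l lef_pV2 ?posrE // ler_nat.
rewrite -(cvg_lim _ cvgF) //; apply: lime_ge; first by apply/cvg_ex; eexists; exact: cvgF.
by apply: nearW => n /=; apply: shift; rewrite invr_gt0.
Qed.

Lemma self_similar_unique theta a0 b0 nu nu' (A : set (measurableTypeR R)) : a0 <= b0 ->
  self_similar H theta nu -> nu `[a0, b0]%classic = 1%E ->
  self_similar H theta nu' -> nu' `[a0, b0]%classic = 1%E ->
  measurable A -> nu' A = nu A.
Proof.
move=> ab ss J1 ss' J1'.
have ray a : nu' `]-oo, a]%classic = nu `]-oo, a]%classic.
  by apply/eqP; rewrite eq_le; apply/andP; split; apply: (@self_similar_ray_le theta a0 b0).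
have oc x y : nu' `]x, y]%classic = nu `]x, y]%classic.
  have -> : `]x, y]%classic = `]-oo, y] `\` `]-oo, x].
    by rewrite -[RHS]setCK setCD setCitvl setUC -[LHS]setCK setCitv.
  have [xy|yx] := leP x y; last first.
    rewrite (_ : _ `\` _ = set0) ?measure0 //; apply/seteqP; split => // z /=.
    by rewrite !in_itv /= => -[zy]; apply; exact: le_trans zy (ltW yx).
  have sub : `]-oo, x] `<=` `]-oo, y] by exact: subset_itvl.
  have fin (n : probability (measurableTypeR R) R) : (n `]-oo, y]%classic < +oo)%E.
    by rewrite -ge0_fin_numE ?fin_num_measure.
  have m z : measurable (`]-oo, z]%classic : set (measurableTypeR R)) by exact: measurable_itv.
  rewrite (measureD (m y) (m x) (fin nu')) (measureD (m y) (m x) (fin nu)).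
  by rewrite setIidr //; congr (_ - _)%E; exact: ray.
move=> mA.
apply: (@measure_unique _ R (measurableTypeR R) (@ocitv R)
  (fun n => `](- n%:R), n%:R]%classic) _ _ _ _ nu' nu _ _ A mA) => //.
- exact: ocitvI.
- by move=> n; exact: is_ocitv.
- rewrite -subTset => x _; exists (Num.bound x) => //=.
  by rewrite in_itv /= ltrNl unstable.ltrNbound ltW // unstable.ltr_bound.
- by move=> _ [[x y] _ <-]; exact: oc.
- by move=> n; rewrite (le_lt_trans (probability_le1 _ _)) ?ltry //; exact: measurable_itv.
Qed.

End uniqueness.

(** * Existence of a self-similar measure *)

Section pushforward_probability.
Context d1 d2 (T1 : measurableType d1) (T2 : measurableType d2) (R : realType).
Variables (P : {measure set T1 -> \bar R}) (D : set T1) (f : T1 -> T2).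
Hypothesis mD : measurable D.
Hypothesis mf : measurable_fun setT f.
Hypothesis PD : P D = 1%E.

Let image_prob (A : set T2) : \bar R := P (D `&` f @^-1` A).

Let mpre A : measurable A -> measurable (D `&` f @^-1` A).
Proof. by move=> mA; apply: measurableI => //; rewrite -[X in measurable X]setTI; exact: mf. Qed.

Let image_prob0 : image_prob set0 = 0%E.
Proof. by rewrite /image_prob preimage_set0 setI0 measure0. Qed.

Let image_prob_ge0 A : (0 <= image_prob A)%E.
Proof. exact: measure_ge0. Qed.

Let image_prob_sigma_additive : semi_sigma_additive image_prob.
Proof.
move=> F mF tF mUF; rewrite /image_prob preimage_bigcup setI_bigcupr.
apply: measure_semi_sigma_additive.
- by move=> n; exact: mpre.
- apply/trivIsetP => /= i j _ _ ij; rewrite setIACA setIid -preimage_setI.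
  by move/trivIsetP : tF => /(_ _ _ _ _ ij) -> //; rewrite preimage_set0 setI0.
- by rewrite -setI_bigcupr -preimage_bigcup; exact: mpre.
Qed.

HB.instance Definition _ := isMeasure.Build _ _ _ image_prob
  image_prob0 image_prob_ge0 image_prob_sigma_additive.

Let image_prob_setT : image_prob setT = 1%E.
Proof. by rewrite /image_prob preimage_setT setIT. Qed.

HB.instance Definition _ := Measure_isProbability.Build _ _ _ image_prob image_prob_setT.

Lemma exists_image_probability :
  exists Q : probability T2 R, forall A, Q A = P (D `&` f @^-1` A).
Proof. by exists image_prob. Qed.

End pushforward_probability.

Section affine.
Variable R : realType.
Implicit Types A : set (measurableTypeR R).

Lemma measurable_affine (c b : R) A : measurable A ->
  measurable ((fun x => c * x + b) @^-1` A : set (measurableTypeR R)).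
Proof.
move=> mA; rewrite -[X in measurable X]setTI.
apply: continuous_measurable_fun mA => // x; apply: cvgD; last exact: cvg_cst.
by apply: cvgMr; exact: cvg_id.
Qed.

Lemma lebesgue_measure_affine (c b : R) A : 0 < c -> measurable A ->
  lebesgue_measure ((fun x => c * x + b) @^-1` A : set (measurableTypeR R)) =
  ((c^-1)%:E * lebesgue_measure A)%E.
Proof.
move=> c0 mA.
pose g : measurableTypeR R -> measurableTypeR R := fun x => c * x + b.
have mg : measurable_fun setT g.
  by move=> _ B mB; rewrite setTI; exact: measurable_affine.
have ci : (0 : R) <= c by exact: ltW.
pose m0 : {measure set (measurableTypeR R) -> \bar R} :=
  mscale (NngNum ci) (pushforward lebesgue_measure g).
pose m := m0 mg.
have mE : lebesgue_measure A = m A.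
  apply: lebesgue_measure_unique => // _ [[x y] _ <-] /=.
  rewrite /m /m0 /mscale /= /pushforward.
  rewrite (_ : g @^-1` _ = `](x - b) / c, (y - b) / c]%classic); last first.
    apply/seteqP; split => z; rewrite /g /= !in_itv /= ltr_pdivrMr // ler_pdivlMr // => /andP[z1 z2];
      apply/andP; split; lra.
  rewrite !lebesgue_measure_itv /= !lte_fin ltr_pM2r ?invr_gt0 // ltrD2r.
  case: ifP => _; last by rewrite mule0.
  rewrite -!EFinB -EFinM; congr (_%:E); field; rewrite gt_eqF //.
rewrite mE /m /m0 /mscale /= /pushforward muleA -EFinM mulVf ?gt_eqF // mul1e.
by [].
Qed.
End affine.

Section existence.
Variables (R : realType) (N : nat) (H : R -> R) (k : R).
Local Notation letter := 'I_N.+1.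
Hypothesis k_gt0 : 0 < k.
Hypothesis k_small : k <= 20^-1.
Hypothesis H_slope : forall a b : R, a <= b -> k * (b - a) <= H b - H a <= 2 * k * (b - a).
Variables (theta : letter -> R) (a0 b0 : R).
Hypothesis ab : a0 <= b0.
Hypothesis branch_J : forall i x, a0 <= x <= b0 -> a0 <= branch H (theta i) x <= b0.

Let B := N.+1%:R : R.

(** The points of the unit interval whose first digit in base N + 1 is i. *)
Definition cell (i : letter) : set (measurableTypeR R) := [set x | i%:R <= B * x < i%:R + 1].

(** The sum selects the branch of the first digit of x.  Writing the selection as
a sum of indicators rather than with a digit function defines it on the
whole line and makes its measurability immediate. *)
Fixpoint coding n (x : R) : R :=
  if n is m.+1 then
    \sum_(i < N.+1) \1_(cell i) x * branch H (theta i) (coding m (B * x + - i%:R))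
  else a0.

Let B0 : 0 < B. Proof. by rewrite ltr0n. Qed.

Lemma cell_inj i j x : cell i x -> cell j x -> i = j.
Proof.
wlog ij : i j / (i <= j)%N.
  by move=> wl ci cj; case/orP: (leq_total i j) => [/wl|/wl->//]; exact.
move=> /andP[i1 i2] /andP[j1 j2]; apply/val_inj/eqP; rewrite eqn_leq ij /=.
by rewrite -ltnS -(ltr_nat R) -natr1 (le_lt_trans j1).
Qed.

Lemma cell_ex x : 0 <= x < 1 -> exists i, cell i x.
Proof.
move=> /andP[x0 x1]; have Bx0 : 0 <= B * x by rewrite mulr_ge0 // ltW.
have /andP[t1 t2] := truncn_itv Bx0.
have tN : (Num.truncn (B * x) < N.+1)%N.
  by rewrite truncn_lt_nat // -[ltRHS]mulr1 ltr_pM2l.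
by exists (Ordinal tN); rewrite /cell /= t1 /= natr1.
Qed.

Lemma cell_sub i x : cell i x -> 0 <= x < 1.
Proof.
move=> /andP[x1 x2]; apply/andP; split.
  by rewrite -(pmulr_rge0 _ B0); apply: le_trans x1.
rewrite -(ltr_pM2l B0) mulr1 (lt_le_trans x2) // natr1 ler_nat.
exact: ltn_ord.
Qed.

Lemma cell_shift i x : cell i x = (0 <= B * x + - i%:R < 1) :> Prop.
Proof.
rewrite /cell /=; congr (is_true (_ && _)); first by rewrite subr_ge0.
by rewrite ltrBlDl.
Qed.

Lemma codingS n i x : cell i x ->
  coding n.+1 x = branch H (theta i) (coding n (B * x + - i%:R)).
Proof.
move=> ix /=; rewrite (bigD1 i) //= indicE mem_set // mul1r big1 ?addr0 // => j ji.
rewrite indicE memNset ?mul0r // => jx.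
by move/eqP: ji; apply; exact: cell_inj jx ix.
Qed.

Lemma coding_itv n x : 0 <= x < 1 -> a0 <= coding n x <= b0.
Proof.
elim: n x => [|n IHn] x x01; first by rewrite /= lexx.
have [i ix] := cell_ex x01; rewrite (codingS _ ix).
by apply/branch_J/IHn; move: ix; rewrite cell_shift.
Qed.

Lemma coding_dist n x : 0 <= x < 1 ->
  `|coding n.+1 x - coding n x| <= (2 * k) ^+ n * (b0 - a0).
Proof.
elim: n x => [|n IHn] x x01.
  rewrite expr0 mul1r ler_norml.
  have := coding_itv 1 x01; rewrite [coding 0 x]/= => /andP[].
  set y := coding 1 x; move=> y1 y2; move: ab => ab'; apply/andP; split; lra.
have [i ix] := cell_ex x01; rewrite !(codingS _ ix).
have := branch_dist k_gt0 H_slope (theta i) (coding n.+1 (B * x + - i%:R)) (coding n (B * x + - i%:R)).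
move=> /andP[_ h]; apply: le_trans h _; rewrite exprS -(mulrA (2 * k)).
by rewrite ler_wpM2l ?mulr_ge0 ?(ltW k_gt0) // IHn //; move: ix; rewrite cell_shift.
Qed.

Lemma cvg_coding x : 0 <= x < 1 -> cvgn (coding ^~ x).
Proof.
move=> x01; pose u n := coding n.+1 x - coding n x.
have cu : cvgn (series u).
  apply: normed_cvg; apply: (series_le_cvg _ _ _ (is_cvg_geometric_series (a := b0 - a0) (z := 2 * k) _)).
  - by move=> n; exact: normr_ge0.
  - move=> n; rewrite /geometric /= mulr_ge0 ?subr_ge0 ?exprn_ge0 ?mulr_ge0 //; exact: ltW.
  - by move=> n; rewrite /geometric /= mulrC; exact: coding_dist.
  - by rewrite ger0_norm ?mulr_ge0 ?(ltW k_gt0) //; move: k_small; lra.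
have -> : coding ^~ x = (fun n => series u n + a0).
  apply/funext => n; rewrite /series /= telescope_sumr // subrK //.
by apply: is_cvgD => //; exact: is_cvg_cst.
Qed.

Definition coding_map (x : R) : R := if (0 <= x < 1) then limn (coding ^~ x) else a0.

Lemma coding_map_itv x : a0 <= coding_map x <= b0.
Proof.
rewrite /coding_map; case: ifP => x01; last by rewrite lexx.
apply/andP; split; [apply: limr_ge|apply: limr_le]; try exact: cvg_coding.
- by apply: nearW => n; case/andP: (coding_itv n x01).
- by apply: nearW => n; case/andP: (coding_itv n x01).
Qed.

Lemma coding_mapE i x : cell i x ->
  coding_map x = branch H (theta i) (coding_map (B * x + - i%:R)).
Proof.
move=> ix; have x01 := cell_sub ix; have y01 := ix; rewrite cell_shift in y01.
rewrite /coding_map x01 y01; apply/cvg_lim => //.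
rewrite -(cvg_shiftS (coding ^~ x)).
rewrite (_ : [sequence _]_n = branch H (theta i) \o (coding ^~ (B * x + - i%:R))); last first.
  by apply/funext => n /=; rewrite -(codingS _ ix).
apply: continuous_cvg; first exact: (continuous_branch k_gt0 k_small H_slope).
exact: cvg_coding.
Qed.

Lemma measurable_cell i : measurable (cell i).
Proof.
rewrite (_ : cell i = (fun x => B * x + 0) @^-1` (`[i%:R, i%:R + 1[%classic : set (measurableTypeR R))).
  by apply: measurable_affine; exact: measurable_itv.
by apply/seteqP; split => x; rewrite /cell /= in_itv /= addr0.
Qed.

Lemma measurable_coding n : measurable_fun setT (coding n : measurableTypeR R -> R).
Proof.
elim: n => [|n IHn]; first exact: measurable_cst.
rewrite (_ : coding n.+1 = fun x => \sum_(i < N.+1)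
  (\1_(cell i) x * branch H (theta i) (coding n (B * x + - i%:R)))) //.
apply: measurable_sum => i; apply: measurable_funM.
  by apply: measurable_indic; exact: measurable_cell.
apply: measurableT_comp.
  apply: continuous_measurable_fun; exact: (continuous_branch k_gt0 k_small H_slope).
apply: (measurableT_comp IHn).
by move=> _ A mA; rewrite setTI; exact: measurable_affine.
Qed.

Lemma measurable_coding_map : measurable_fun setT (coding_map : measurableTypeR R -> R).
Proof.
pose D : set (measurableTypeR R) := `[0, 1[%classic.
have mD : measurable D by exact: measurable_itv.
have md : measurable_fun D (coding_map : measurableTypeR R -> R).
  apply: (measurable_fun_cvg (h := coding)).
    by move=> n; apply: measurable_funTS; exact: measurable_coding.
  move=> x; rewrite /D /= in_itv /= => x01; rewrite /coding_map x01; exact: cvg_coding.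
rewrite (_ : setT = D `|` ~` D); last by rewrite setUv.
apply/measurable_funU => //; first exact: measurableC.
split => //; apply: (eq_measurable_fun (fun=> a0)); last exact: measurable_cst.
move=> x; rewrite inE /D /= in_itv /= /coding_map; by case: ifP.
Qed.

(** Conditionally on its first digit i, a uniform point of the unit interval is
the image of a uniform point under an affine map of slope 1/(N+1), and the
coding turns that affine map into the i-th branch. *)
Lemma exists_self_similar : exists nu : probability (measurableTypeR R) R,
  self_similar H theta nu /\ nu `[a0, b0]%classic = 1%E.
Proof.
pose D : set (measurableTypeR R) := `[0, 1[%classic.
have mD : measurable D by exact: measurable_itv.
have D1 : lebesgue_measure D = 1%E.
  by rewrite lebesgue_measure_itv /= lte_fin ltr01 oppr0 adde0.
have mcm : measurable_fun setT (coding_map : measurableTypeR R -> measurableTypeR R).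
  exact: measurable_coding_map.
have [nu nuE] := exists_image_probability mD mcm D1.
exists nu; split; last first.
  rewrite nuE (_ : _ `&` _ = D) //; apply/seteqP; split => x; first by case.
  by move=> Dx; split => //=; rewrite in_itv /=; exact: coding_map_itv.
move=> A mA; rewrite nuE.
have mpre C : measurable C -> measurable (D `&` coding_map @^-1` C).
  by move=> mC; apply: measurableI => //; rewrite -[X in measurable X]setTI; exact: measurable_coding_map.
have piece (i : letter) : cell i `&` coding_map @^-1` A =
   (fun x => B * x + - i%:R) @^-1` (D `&` coding_map @^-1` (branch H (theta i) @^-1` A)).
  apply/seteqP; split => x /=.
    move=> [ix Ax]; split; first by rewrite /D /= in_itv /=; move: ix; rewrite cell_shift.
    by rewrite -(coding_mapE ix).
  rewrite /D /= in_itv /= => -[]; rewrite -cell_shift => ix Ax.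
  by split => //=; rewrite (coding_mapE ix).
have -> : D `&` coding_map @^-1` A = \big[setU/set0]_(i < N.+1) (cell i `&` coding_map @^-1` A).
  apply/seteqP; split => x; rewrite -bigcup_seq /=.
    by rewrite /D /= in_itv /= => -[/cell_ex[i ix] Ax]; exists i; rewrite //= mem_index_enum.
  by move=> [i _ [/= ix Ax]]; split => //; rewrite /D /= in_itv /=; exact: cell_sub ix.
have mc (i : letter) : measurable (cell i `&` coding_map @^-1` A).
  rewrite piece; apply: measurable_affine; apply: mpre.
  exact: (measurable_branch k_gt0 k_small H_slope).
rewrite measure_semi_additive_ord //; first last.
- by apply: bigsetU_measurable.
- apply/trivIsetP => i j _ _ ij; apply/seteqP; split => // x [[ix _] [jx _]].
  by move/eqP: ij; apply; exact: cell_inj ix jx.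
rewrite ge0_sume_distrr; last by move=> i _; exact: measure_ge0.
apply: eq_bigr => i _; rewrite nuE piece; apply: lebesgue_measure_affine => //.
by apply: mpre; exact: (measurable_branch k_gt0 k_small H_slope).
Qed.

End existence.

(** * The action of a diagonal matrix on angles *)

Section angle_map.
Variable R : realType.
Implicit Types k x a b : R.

(** The action on angles of the diagonal matrix with eigenvalues l and 1/l, where
k = l^-2. *)
Definition angle_map k x : R := atan (k * tan x).

Lemma is_derive_angle_map k x : cos x != 0 ->
  is_derive x 1 (angle_map k) ((1 + (k * tan x) ^+ 2)^-1 * (k * cos x ^- 2)).
Proof.
by move=> cx; apply: (@is_derive1_comp _ atan (fun x => k * tan x)).
Qed.

Lemma cos_pi4_sqr x : - (pi / 4) <= x <= pi / 4 -> 2^-1 <= cos x ^+ 2.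
Proof.
move=> /andP[x1 x2].
have : 0 <= cos (x *+ 2).
  by apply: cos_ge0_pihalf; apply/andP; split; lra.
by rewrite cos_mulr2n; lra.
Qed.

(** The derivative is k (1 + T^2) / (1 + k^2 T^2) with T = tan x, and |T| <= 1 on
the interval considered. *)
Lemma angle_map_slope k a b : 0 < k <= 1 -> a <= b ->
  - (pi / 4) <= a -> b <= pi / 4 ->
  k * (b - a) <= angle_map k b - angle_map k a <= 2 * k * (b - a).
Proof.
move=> /andP[k0 k1] ab a1 b1.
have cos0 x : - (pi / 4) <= x <= pi / 4 -> cos x != 0.
  by move=> /cos_pi4_sqr; apply: contraTneq => ->; rewrite expr0n /= -ltNge invr_gt0.
have der x : x \in `]a, b[%R ->
    is_derive x 1 (angle_map k) ((1 + (k * tan x) ^+ 2)^-1 * (k * cos x ^- 2)).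
  rewrite in_itv /= => /andP[x1 x2]; apply: is_derive_angle_map.
  by apply: cos0; apply/andP; split; lra.
have cont : {within `[a, b], continuous (angle_map k)}.
  apply: continuous_in_subspaceT => x; rewrite inE /= in_itv /= => /andP[x1 x2].
  apply: differentiable_continuous; apply/derivable1_diffP.
  have cx : cos x != 0 by apply: cos0; apply/andP; split; lra.
  by have [] := is_derive_angle_map k cx.
have [c] := MVT_segment ab der cont.
rewrite in_itv /= => /andP[c1 c2] ->.
have c14 : - (pi / 4) <= c <= pi / 4 by apply/andP; split; lra.
have cc := cos0 _ c14; have := cos_pi4_sqr c14; rewrite cos2_tan2 //.
have : cos c ^- 2 <= 2 -> tan c ^+ 2 <= 1 by rewrite cos2_tan2 //; lra.
move=> tan1 cos1.
have t1 : tan c ^+ 2 <= 1.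
  by apply: tan1; rewrite -[leRHS]invrK lef_pV2 // posrE ?invr_gt0 // (lt_le_trans _ cos1) ?invr_gt0.
have t0 : 0 <= tan c ^+ 2 by rewrite sqr_ge0.
have kt : 0 <= k ^+ 2 * tan c ^+ 2 <= tan c ^+ 2.
  by rewrite mulr_ge0 ?sqr_ge0 //= ler_piMl // expr_le1 // ltW.
have ba : 0 <= b - a by rewrite subr_ge0.
have kt1 : 0 < 1 + k ^+ 2 * tan c ^+ 2 by lra.
rewrite exprMn (mulrC (_^-1)).
apply/andP; split; rewrite ler_wpM2r //.
  by rewrite ler_pdivlMr // ler_pM2l //; lra.
rewrite ler_pdivrMr // -mulrA [leRHS]mulrCA ler_pM2l //; lra.
Qed.

Definition clamp x : R := Num.max (- (pi / 4)) (Num.min (pi / 4) x).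

(** An extension of the angle map to the whole line that keeps its slope between k
and 2k, so that the theory of the previous parts applies without domain
restrictions. *)
Definition branch_map k x : R := angle_map k (clamp x) + k * (x - clamp x).

Lemma branch_mapE k x : - (pi / 4) <= x <= pi / 4 -> branch_map k x = angle_map k x.
Proof.
move=> /andP[x1 x2]; rewrite /branch_map /clamp min_r // max_r //.
by rewrite subrr mulr0 addr0.
Qed.

Lemma branch_map_slope k a b : 0 < k <= 1 -> a <= b ->
  k * (b - a) <= branch_map k b - branch_map k a <= 2 * k * (b - a).
Proof.
move=> k01 ab; have /andP[k0 _] := k01.
have p4 : 0 < pi / 4 :> R by rewrite divr_gt0 // pi_gt0.
have clampP x : [\/ x <= - (pi / 4) /\ clamp x = - (pi / 4), pi / 4 <= x /\ clamp x = pi / 4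
    | [/\ - (pi / 4) <= x, x <= pi / 4 & clamp x = x]].
  rewrite /clamp; have [x1|x1] := leP (pi / 4) x.
    by constructor 2; split => //; rewrite max_r //; lra.
  have [x2|x2] := leP (- (pi / 4)) x; first by constructor 3; split => //; exact: ltW.
  by constructor 1; split => //; exact: ltW.
have [ca1 ca2] : - (pi / 4) <= clamp a /\ clamp a <= pi / 4.
  by case: (clampP a) => [[? ->]|[? ->]|[? ? ->]]; split; lra.
have [cb1 cb2] : - (pi / 4) <= clamp b /\ clamp b <= pi / 4.
  by case: (clampP b) => [[? ->]|[? ->]|[? ? ->]]; split; lra.
have [cab cabd] : clamp a <= clamp b /\ clamp b - clamp a <= b - a.
  by case: (clampP a) => [[? ->]|[? ->]|[? ? ->]];
     case: (clampP b) => [[? ->]|[? ->]|[? ? ->]]; split; lra.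
have /andP[h1 h2] := angle_map_slope k01 cab ca1 cb2.
have : k * (clamp b - clamp a) <= k * (b - a) by rewrite ler_pM2l.
by rewrite /branch_map => h3; apply/andP; split; lra.
Qed.

End angle_map.

(** * Lines, frames and matrices with prescribed axis *)

Section lines.
Variable R : realType.

Definition line (t : R) : P1 R := P1_line (vec_circle t).

Lemma P1_lineP (v w : nzvec R) :
  P1_line v = P1_line w <-> exists2 c : R, c != 0 & val v = c *: val w.
Proof.
split=> [/eqmodP /asboolP //|h].
by apply/eqmodP; rewrite /=; apply/asboolP.
Qed.

Lemma ord2P (i : 'I_2) : i = 0 \/ i = 1.
Proof. by case: i => [[|[|//]] ?]; [left|right]; exact: val_inj. Qed.

Lemma cV2P (u v : 'cV[R]_2) : u 0 0 = v 0 0 -> u 1 0 = v 1 0 -> u = v.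
Proof. by move=> h0 h1; apply/matrixP => i j; rewrite (ord1 j); case: (ord2P i) => ->. Qed.

Lemma mul2cV (M : 'M[R]_2) (u : 'cV[R]_2) i :
  (M *m u) i 0 = M i 0 * u 0 0 + M i 1 * u 1 0.
Proof. by rewrite !mxE !big_ord_recl big_ord0 addr0; congr (_ * _ + M i _ * u _ _); exact: val_inj. Qed.

Lemma vec20 (x y : R) : vec2 x y 0 0 = x. Proof. by rewrite mxE. Qed.
Lemma vec21 (x y : R) : vec2 x y 1 0 = y. Proof. by rewrite mxE. Qed.

Lemma scale_vec2 (c x y : R) : c *: vec2 x y = vec2 (c * x) (c * y).
Proof. by apply: cV2P; rewrite !mxE. Qed.

Lemma rot_mx_vec (a x y : R) :
  rot_mx a *m vec2 x y = vec2 (cos a * x - sin a * y) (sin a * x + cos a * y).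
Proof. by apply: cV2P; rewrite mul2cV !vec20 !vec21 !mxE /= ?mulNr. Qed.

Lemma rot_mx_circle (a t : R) :
  rot_mx a *m vec2 (cos t) (sin t) = vec2 (cos (a + t)) (sin (a + t)).
Proof. by rewrite rot_mx_vec cosD sinD addrC (addrC (sin a * cos t)). Qed.

Lemma cos_atan_gt0 (x : R) : 0 < cos (atan x).
Proof. by apply: cos_gt0_pihalf; have [-> _] := atan_def x. Qed.

Lemma sin_atan (x : R) : sin (atan x) = x * cos (atan x).
Proof.
have : sin (atan x) / cos (atan x) = x by exact: atanK.
by move=> /(congr1 (fun y => y * cos (atan x))); rewrite mulfVK // gt_eqF // cos_atan_gt0.
Qed.

Definition frame0 (a : R) (v : nzvec R) : R := cos a * val v 0 0 + sin a * val v 1 0.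
Definition frame1 (a : R) (v : nzvec R) : R := cos a * val v 1 0 - sin a * val v 0 0.

Lemma line_frame (a : R) (v : nzvec R) : frame0 a v != 0 ->
  P1_line v = line (a + atan (frame1 a v / frame0 a v)).
Proof.
move=> x0; apply/P1_lineP.
set x := frame0 a v in x0 *; set y := frame1 a v; set t := atan _.
have ct : 0 < cos t by exact: cos_atan_gt0.
exists (x / cos t); first by rewrite mulf_neq0 // invr_eq0 gt_eqF.
rewrite /= -rot_mx_circle scalemxAr scale_vec2 sin_atan -/t.
rewrite (_ : x / cos t * cos t = x); last by rewrite mulfVK // gt_eqF.
rewrite (_ : x / cos t * _ = y); last by field; rewrite x0 gt_eqF.
have cs := cos2Dsin2 a.
rewrite rot_mx_vec /x /y /frame0 /frame1; apply: cV2P; rewrite ?vec20 ?vec21.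
  rewrite -[LHS]mul1r -cs; ring.
by rewrite -[LHS]mul1r -cs; ring.
Qed.

Lemma frame_neq0 (a : R) (v : nzvec R) : frame0 a v = 0 -> frame1 a v = 0 -> False.
Proof.
rewrite /frame0 /frame1 => h0 h1; have cs := cos2Dsin2 a.
have := valP v; apply/negP; rewrite negbK; apply/eqP/cV2P; rewrite mxE -[LHS]mul1r -cs.
  rewrite (_ : _ * _ = cos a * (cos a * val v 0 0 + sin a * val v 1 0)
     - sin a * (cos a * val v 1 0 - sin a * val v 0 0)); last by ring.
  by rewrite h0 h1 !mulr0 subr0.
rewrite (_ : _ * _ = sin a * (cos a * val v 0 0 + sin a * val v 1 0)
     + cos a * (cos a * val v 1 0 - sin a * val v 0 0)); last by ring.
by rewrite h0 h1 !mulr0 addr0.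
Qed.

Lemma P1_line_surj (x : P1 R) : exists v, x = P1_line v.
Proof. by exists (repr x); rewrite /P1_line reprK. Qed.

(** A line that is an axis of the first frame is oblique to the second one, as
the two frames are neither equal nor orthogonal. *)
Lemma exists_oblique_frame (a b : R) (x : P1 R) : sin (b - a) != 0 -> cos (b - a) != 0 ->
  exists c t, [/\ c = a \/ c = b, x = line (c + t), - (pi / 2) < t < pi / 2 & t != 0].
Proof.
move=> sab cab; have [v ->] := P1_line_surj x.
suff [c cE [c0 c1]] : exists2 c, c = a \/ c = b & frame0 c v != 0 /\ frame1 c v != 0.
  exists c, (atan (frame1 c v / frame0 c v)); split => //; first exact: line_frame.
    by have [-> _] := atan_def (frame1 c v / frame0 c v).
  apply/eqP => /(congr1 tan); rewrite atanK tan0 => /eqP.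
  by rewrite mulf_eq0 invr_eq0 (negbTE c0) (negbTE c1).
have f0 : frame0 b v = cos (b - a) * frame0 a v + sin (b - a) * frame1 a v.
  have cs := cos2Dsin2 a; rewrite cosB sinB /frame0 /frame1.
  rewrite -[LHS]mul1r -cs; ring.
have f1 : frame1 b v = cos (b - a) * frame1 a v - sin (b - a) * frame0 a v.
  have cs := cos2Dsin2 a; rewrite cosB sinB /frame0 /frame1.
  rewrite -[LHS]mul1r -cs; ring.
have [a0|a0] := eqVneq (frame0 a v) 0.
  have a1 : frame1 a v != 0 by apply/eqP => a1; exact: frame_neq0 a0 a1.
  exists b; first by right.
  by rewrite f0 f1 a0 !mulr0 add0r subr0 !mulf_neq0.
have [a1|a1] := eqVneq (frame1 a v) 0; last by exists a; [left|].
exists b; first by right.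
by rewrite f0 f1 a1 !mulr0 addr0 sub0r oppr_eq0 !mulf_neq0.
Qed.

End lines.

Section axis_elements.
Variables (R : realType) (l : R).
Hypothesis l_gt0 : 0 < l.

Fact diag_det : \det (diag_mx (\row_(i < 2) (if i == 0 then l else l^-1))) == 1.
Proof. by rewrite det_diag !big_ord_recl big_ord0 !mxE /= mulr1 mulfV // gt_eqF. Qed.

Definition diag_elt : SL2 R := Sub (diag_mx (\row_(i < 2) (if i == 0 then l else l^-1))) diag_det.

(** In this form it is visibly conjugate to a diagonal matrix by a rotation. *)
Definition axis_elt (a : R) : PSL2 R :=
  (PSL2_class (rot a) * PSL2_class diag_elt * (PSL2_class (rot a))^-1)%g.

Lemma axis_eltE a : axis_elt a = PSL2_class (rot a * diag_elt * (rot a)^-1)%g.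
Proof.
rewrite /axis_elt -!PSL2_mul_class -PSL2_inv_class //.
Qed.

Lemma diag_elt_vec x y : val diag_elt *m vec2 x y = vec2 (l * x) (l^-1 * y).
Proof. by apply: cV2P; rewrite mul2cV !vec20 !vec21 !mxE /= ?mulr1n ?mulr0n ?mul0r ?addr0 ?add0r. Qed.

Lemma axis_elt_line a t : - (pi / 2) < t < pi / 2 ->
  PSL2_act (axis_elt a) (line (a + t)) = line (a + angle_map (l ^- 2) t).
Proof.
move=> t2; rewrite axis_eltE PSL2_act_class; apply/P1_lineP.
have ct : 0 < cos t by exact: cos_gt0_pihalf.
rewrite /angle_map; set h := atan _; have ch : 0 < cos h by exact: cos_atan_gt0.
exists (l * cos t / cos h); first by rewrite !mulf_neq0 ?invr_eq0 ?gt_eqF.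
rewrite val_SL2_act /= -!rot_mx_circle -!mulmxA mulKmx ?(SL2_unit (rot a)) // diag_elt_vec.
rewrite scalemxAr scale_vec2; congr (_ *m vec2 _ _).
  by rewrite mulfVK // gt_eqF.
rewrite sin_atan -/h /tan; field.
by rewrite !gt_eqF.
Qed.

Lemma axis_elt_iter a t n : - (pi / 2) < t < pi / 2 ->
  iter n (PSL2_act (axis_elt a)) (line (a + t)) = line (a + atan (l ^- 2 ^+ n * tan t)).
Proof.
move=> t2; elim: n => [|n IHn].
  by rewrite expr0 mul1r tanK // in_itv /= t2.
rewrite iterS IHn axis_elt_line; last first.
  by have [-> _] := atan_def (l ^- 2 ^+ n * tan t).
by rewrite /angle_map atanK mulrA -exprS.
Qed.

Lemma PSL2_class_expg (M : SL2 R) n : (PSL2_class M ^+ n)%g = PSL2_class (M ^+ n)%g.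
Proof.
elim: n => [//|n IHn].
by rewrite !expgS IHn -PSL2_mul_class.
Qed.

Lemma diag_elt_expg n : val (diag_elt ^+ n)%g 0 0 = l ^+ n /\ val (diag_elt ^+ n)%g 1 1 = l ^- n.
Proof.
elim: n => [|n [IH0 IH1]]; first by rewrite !mxE !expr0 invr1.
by rewrite expgS /= mul_diag_mx !mxE /= IH0 IH1 !exprS invfM.
Qed.

Lemma axis_elt_expg a n :
  (axis_elt a ^+ n)%g = PSL2_class (rot a * diag_elt ^+ n * (rot a)^-1)%g.
Proof.
rewrite axis_eltE PSL2_class_expg; congr PSL2_class.
elim: n => [|n IHn]; first by rewrite !expg0 mulg1 mulgV.
by rewrite expgS IHn expgS !mulgA mulgVK.
Qed.

Lemma trace_axis_elt a n :
  \tr (val (rot a * diag_elt ^+ n * (rot a)^-1)%g) = l ^+ n + l ^- n.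
Proof.
rewrite /= mxtrace_mulC mulmxA mulVmx ?(SL2_unit (rot a)) // mul1mx.
have [e0 e1] := diag_elt_expg n.
rewrite /mxtrace !big_ord_recl big_ord0 addr0.
have -> : lift ord0 ord0 = 1 :> 'I_2 by exact: val_inj.
by rewrite -e1 -e0.
Qed.

End axis_elements.

Section frame_slope.
Variable R : realType.

(** This separates the points of the orbit of a line under an element whose axis
has the direction a. *)
Definition frame_slope (a : R) (x : P1 R) : R := frame1 a (repr x) / frame0 a (repr x).

Lemma frame_slope_line (a t : R) : frame_slope a (line (a + t)) = tan t.
Proof.
rewrite /frame_slope /line.
have : P1_line (repr (P1_line (vec_circle (a + t)))) = P1_line (vec_circle (a + t)).
  by rewrite /P1_line reprK.
move=> /P1_lineP[c c0 e]; rewrite /frame0 /frame1 e !mxE /=.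
have cs := cos2Dsin2 a.
have -> : cos a * (c * cos (a + t)) + sin a * (c * sin (a + t)) = c * cos t.
  by rewrite cosD sinD -[RHS]mul1r -cs; ring.
have -> : cos a * (c * sin (a + t)) - sin a * (c * cos (a + t)) = c * sin t.
  by rewrite cosD sinD -[RHS]mul1r -cs; ring.
by rewrite -mulf_div divff // mul1r.
Qed.

End frame_slope.

(** * Topology and measurability *)

Section topology.
Local Open Scope quotient_scope.
Variable R : realType.

Lemma continuous_mx (T : topologicalType) m n (f : T -> 'M[R]_(m, n)) :
  (forall i j, continuous (fun x => f x i j)) -> continuous f.
Proof.
move=> cf x; apply/cvg_ballP => e e0.
have H : \forall y \near x, forall i j, ball (f x i j) e (f y i j).
  apply: filter_forall => i; apply: filter_forall => j.
  by have /cvg_ballP/(_ _ e0) := cf i j x.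
by near=> y; split => //; near: y.
Unshelve. all: by end_near. Qed.

Lemma continuous_mulmx m n p (M : 'M[R]_(m, n)) : continuous (fun v : 'M[R]_(n, p) => M *m v).
Proof.
apply: continuous_mx => i j v.
rewrite (_ : (fun x => _) = (fun x : 'M[R]_(n, p) => \sum_k M i k * x k j)); last first.
  by apply/funext => x; rewrite mxE.
apply: (continuous_big (op := +%R)); first exact: add_continuous.
move=> l _ x.
apply: (@continuous_comp _ _ _ (fun y : 'M[R]_(n, p) => y l j) ( *%R (M i l))).
  exact: coord_continuous.
exact: mulrl_continuous.
Qed.

Lemma continuous_val_nzvec : continuous (val : nzvec R -> 'cV[R]_2).
Proof. exact: initial_continuous. Qed.

Lemma continuous_val_SL2 : continuous (val : SL2 R -> 'M[R]_2).
Proof. exact: initial_continuous. Qed.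

Lemma continuous_P1_line : continuous (@P1_line R).
Proof. exact: pi_continuous. Qed.

Lemma continuous_line : continuous (@line R).
Proof.
have h : continuous (@vec_circle R).
  apply: continuous_comp_initial; apply: continuous_mx => i j t.
  case: (ord2P i) => ->.
    rewrite (_ : (fun x => _) = cos); first exact: continuous_cos.
    by apply/funext => x; rewrite /= mxE.
  rewrite (_ : (fun x => _) = sin); first exact: continuous_sin.
  by apply/funext => x; rewrite /= mxE.
by move=> t; apply: continuous_comp; [exact: h|exact: continuous_P1_line].
Qed.

Lemma continuous_PSL2_act (g : PSL2 R) : continuous (PSL2_act g).
Proof.
apply/quotient_continuous.
rewrite (_ : _ \o _ = @P1_line R \o SL2_act (repr g)); last first.
  by apply/funext => v /=; rewrite -[in LHS](PSL2_reprK g) PSL2_act_class.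
have h : continuous (SL2_act (repr g)).
  apply: continuous_comp_initial.
  change (continuous ((fun u : 'cV[R]_2 => val (repr g) *m u) \o (val : nzvec R -> 'cV[R]_2))).
  move=> v; apply: continuous_comp; first exact: continuous_val_nzvec.
  exact: continuous_mulmx.
by move=> t; apply: continuous_comp; [exact: h|exact: continuous_P1_line].
Qed.

Lemma open_borel (T : ptopologicalType) (U : set T) : open U -> measurable (U : set (borel T)).
Proof. by move=> oU; apply: sub_sigma_algebra. Qed.

Lemma measurable_borel_fun d (T1 : measurableType d) (T : ptopologicalType) (f : T1 -> borel T) :
  (forall U : set T, open U -> measurable (f @^-1` U)) -> measurable_fun setT f.
Proof.
move=> h; apply: (@measurability _ _ _ _ _ f (@open T)) => //.
by move=> _ [U oU <-]; rewrite setTI; exact: h.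
Qed.

Lemma measurable_line : measurable_fun setT (@line R : measurableTypeR R -> borel (P1 R)).
Proof.
apply: measurable_borel_fun => U oU; apply: open_measurable.
by apply: open_comp => // x _; exact: continuous_line.
Qed.

Lemma measurable_PSL2_act (g : PSL2 R) :
  measurable_fun setT (PSL2_act g : borel (P1 R) -> borel (P1 R)).
Proof.
apply: measurable_borel_fun => U oU; apply: open_borel.
by apply: open_comp => // x _; exact: continuous_PSL2_act.
Qed.

(** The inverse of the parametrization by angles in ]0, pi[, measured from the
vertical so that it is continuous away from the horizontal line, where it
takes the value pi / 2. *)
Definition angle (x : P1 R) : R := pi / 2 - atan (val (repr x) 0 0 / val (repr x) 1 0).

Lemma angle_P1_line (v : nzvec R) :
  angle (P1_line v) = pi / 2 - atan (val v 0 0 / val v 1 0).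
Proof.
rewrite /angle; have : P1_line (repr (P1_line v)) = P1_line v by rewrite /P1_line reprK.
move=> /P1_lineP[c c0 ->]; rewrite !mxE.
by rewrite -mulf_div divff // mul1r.
Qed.

Lemma angle_line t : 0 < t < pi -> angle (line t) = t.
Proof.
move=> /andP[t0 tpi]; rewrite /line angle_P1_line /= vec20 vec21.
have := cosDpihalf (t - pi / 2); have := sinDpihalf (t - pi / 2); rewrite subrK => -> ->.
rewrite mulNr atanN opprK -/(tan _) tanK ?in_itv /=; first by rewrite addrC subrK.
by apply/andP; split; lra.
Qed.

Definition non_horizontal : set (P1 R) := [set x : P1 R | val (repr x) 1 0 != 0].

Lemma non_horizontalP (v : nzvec R) : non_horizontal (P1_line v) <-> val v 1 0 != 0.
Proof.
rewrite /non_horizontal /=.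
have : P1_line (repr (P1_line v)) = P1_line v by rewrite /P1_line reprK.
by move=> /P1_lineP[c c0 ->]; rewrite !mxE mulf_eq0 (negbTE c0).
Qed.

Lemma line_angle x : non_horizontal x -> line (angle x) = x.
Proof.
have [v ->] := P1_line_surj x => /non_horizontalP v1; rewrite angle_P1_line.
set q := val v 0 0 / val v 1 0; apply/esym/P1_lineP.
have cq := cos_atan_gt0 q; exists (val v 1 0 / cos (atan q)).
  by rewrite mulf_neq0 // invr_eq0 gt_eqF.
rewrite /= scale_vec2.
rewrite (_ : cos (pi / 2 - atan q) = sin (atan q)); last first.
  by rewrite cosB cos_pihalf sin_pihalf mul0r mul1r add0r.
rewrite (_ : sin (pi / 2 - atan q) = cos (atan q)); last first.
  by rewrite sinB cos_pihalf sin_pihalf mul0r mul1r subr0.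
rewrite sin_atan; apply: cV2P; rewrite ?vec20 ?vec21.
  by rewrite /q; field; rewrite v1 gt_eqF.
by rewrite mulfVK // gt_eqF.
Qed.

Let open_angle_preimage (O : set R) : open O -> open (non_horizontal `&` angle @^-1` O).
Proof.
pose F (u : 'cV[R]_2) := pi / 2 - atan (u 0 0 / u 1 0).
have cF (u : 'cV[R]_2) : u 1 0 != 0 -> {for u, continuous F}.
  move=> u1.
  apply: (@continuous_comp _ _ _ (fun u : 'cV[R]_2 => u 0 0 / u 1 0) (fun y => pi / 2 - atan y)).
    apply: (@continuousM _ _ (fun u : 'cV[R]_2 => u 0 0) (fun u : 'cV[R]_2 => (u 1 0)^-1)).
      exact: coord_continuous.
    apply: (@continuousV _ _ (fun u : 'cV[R]_2 => u 1 0)) => //; exact: coord_continuous.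
  by apply: cvgB; [exact: cvg_cst|exact: continuous_atan].
move=> oO.
  have : open [set u : 'cV[R]_2 | u 1 0 != 0 /\ O (F u)].
    rewrite openE => u /= [u1 Ou].
    have n1 : nbhs u [set u : 'cV[R]_2 | u 1 0 != 0].
      have h : nbhs (u 1 0) [set x : R | x != 0].
        by apply: open_nbhs_nbhs; split => //; exact: open_neq.
      exact: (@coord_continuous R 2 1 1 0 u _ h).
    have n2 : nbhs u (F @^-1` O) by exact: (cF _ u1 _ (open_nbhs_nbhs (conj oO Ou))).
    exact: filterI n1 n2.
  move=> oW.
  have : open ((val : nzvec R -> _) @^-1` [set u : 'cV[R]_2 | u 1 0 != 0 /\ O (F u)]).
    by apply: open_comp => // x _; exact: continuous_val_nzvec.
rewrite (_ : _ @^-1` _ = \pi_(P1 R) @^-1` (non_horizontal `&` angle @^-1` O)) //.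
apply/seteqP; split => v /=.
  move=> [v1 Ov]; split; first exact/non_horizontalP.
  by have := angle_P1_line v; rewrite /P1_line => ->.
by move=> [/non_horizontalP v1]; have := angle_P1_line v; rewrite /P1_line => ->.
Qed.

Lemma measurable_non_horizontal : measurable (non_horizontal : set (borel (P1 R))).
Proof.
apply: open_borel; have := open_angle_preimage openT.
by rewrite preimage_setT setIT.
Qed.

(** The angle is continuous on the open set of non-horizontal lines and constant
on its complement. *)
Lemma measurable_angle : measurable_fun setT (angle : borel (P1 R) -> measurableTypeR R).
Proof.
refine (@measurability _ _ (borel (P1 R)) (measurableTypeR R) setT angle
  (@RGenOpens.G R) (RGenOpens.measurableE R) _).
move=> _ [_ [x [y ->]] <-]; rewrite setTI.
have mD := measurable_non_horizontal; set D := non_horizontal.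
set O := `]x, y[%classic.
have mDO : measurable (D `&` angle @^-1` O : set (borel (P1 R))).
  by apply: open_borel; apply: open_angle_preimage; exact: itv_open.
have angleNE z : ~ D z -> angle z = pi / 2.
  by move=> /negP; rewrite negbK /angle => /eqP ->; rewrite invr0 mulr0 atan0 subr0.
have [Op|Op] := pselect (O (pi / 2)).
  rewrite (_ : angle @^-1` O = (D `&` angle @^-1` O) `|` ~` D).
    by apply: measurableU => //; exact: measurableC.
  apply/seteqP; split => z; last by case=> [[] //|/angleNE /= ->].
  by move=> Oz; have [Dz|Dz] := pselect (D z); [left|right].
rewrite (_ : angle @^-1` O = D `&` angle @^-1` O) //.
apply/seteqP; split => z; last by case.
by move=> Oz; split => //; apply: contrapT => /angleNE e; apply: Op; rewrite -e.
Qed.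

(** Unlike the trace, its absolute value is well defined on the quotient. *)
Definition abs_trace (g : PSL2 R) : R := `|\tr (val (repr g))|.

Lemma abs_trace_class M : abs_trace (PSL2_class M) = `|\tr (val M)|.
Proof.
rewrite /abs_trace; case: (repr_PSL2_class M) => -> //=.
by rewrite raddfN normrN.
Qed.

Lemma continuous_abs_trace : continuous abs_trace.
Proof.
apply/quotient_continuous.
rewrite (_ : _ \o _ = fun M : SL2 R => `|\tr (val M)|); last first.
  by apply/funext => M; rewrite /= -abs_trace_class.
have ct : continuous (fun M : 'M[R]_2 => \tr M).
  move=> M; rewrite /mxtrace; apply: (continuous_big (op := +%R)); first exact: add_continuous.
  by move=> i _; exact: coord_continuous.
change (continuous ((fun x : R => `|x|) \o ((fun M : 'M[R]_2 => \tr M) \o (val : SL2 R -> 'M[R]_2)))).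
move=> M; apply: continuous_comp; last exact: norm_continuous.
by apply: continuous_comp; [exact: continuous_val_SL2|exact: ct].
Qed.

Lemma closed_PSL2_set1 (g : PSL2 R) : closed [set g].
Proof.
rewrite -openC.
have closed1 (A : 'M[R]_2) : closed [set A].
  by apply: accessible_closed_set1; apply: hausdorff_accessible; exact: norm_hausdorff.
have : open ((val : SL2 R -> _) @^-1` (~` [set val (repr g)] `&` ~` [set - val (repr g)])).
  apply: open_comp => [x _|]; first exact: continuous_val_SL2.
  by apply: openI; rewrite openC; exact: closed1.
rewrite (_ : _ @^-1` _ = \pi_(PSL2 R) @^-1` ~` [set g]) //.
apply/seteqP; split => M /=.
  move=> [h1 h2] e; have : PSL2_class M = PSL2_class (repr g) by rewrite PSL2_reprK.
  by move=> /PSL2_classP[eM|eM]; [apply: h1|apply: h2]; rewrite eM.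
move=> h; split => e; apply: h; rewrite -[RHS]PSL2_reprK; apply/PSL2_classP.
  by left; apply: val_inj.
by right; apply: val_inj.
Qed.

End topology.

(** * Uniform measures on finite families *)

Section mean_dirac.
Import HBNNSimple.
Context d (T : measurableType d) (R : realType) (N : nat) (g : 'I_N.+1 -> T).

Let invN_nng : 0 <= (N.+1%:R : R)^-1. Proof. by rewrite invr_ge0. Qed.

Definition mean_dirac : set T -> \bar R :=
  mscale (NngNum invN_nng) (msum (fun i => \d_(g (inord i))) N.+1).

HB.instance Definition _ := Measure.on mean_dirac.

Lemma mean_diracE A : mean_dirac A = ((N.+1%:R^-1)%:E * \sum_(i < N.+1) \d_(g i) A)%E.
Proof.
rewrite /mean_dirac /mscale /msum /=; congr (_ * _)%E.
by apply: eq_bigr => i _; rewrite inord_val.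
Qed.

Let mean_dirac_setT : mean_dirac setT = 1%E.
Proof.
rewrite mean_diracE (eq_bigr (fun=> 1%E)); last by move=> i _; rewrite diracT.
by rewrite sumEFin sumr_const card_ord -EFinM mulVf // pnatr_eq0.
Qed.

HB.instance Definition _ := Measure_isProbability.Build _ _ _ mean_dirac mean_dirac_setT.

Lemma mean_dirac_gt0 i A : A (g i) -> (0 < mean_dirac A)%E.
Proof.
move=> Agi; rewrite mean_diracE mule_gt0 ?lte_fin ?invr_gt0 ?ltr0n //.
rewrite (bigD1 i) //= diracE mem_set // lte_paddr //.
by apply: sume_ge0 => j _; exact: measure_ge0.
Qed.

Lemma mean_dirac_eq0 A : (forall i, ~ A (g i)) -> mean_dirac A = 0%E.
Proof.
by move=> Ag; rewrite mean_diracE big1 ?mule0 // => i _; rewrite diracE memNset.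
Qed.

Lemma integral_mean_dirac_measurable (f : T -> \bar R) : measurable_fun setT f ->
  (forall x, 0 <= f x)%E ->
  (\int[mean_dirac]_x f x = (N.+1%:R^-1)%:E * \sum_(i < N.+1) f (g i))%E.
Proof.
move=> mf f0; rewrite ge0_integral_mscale //=; congr (_ * _)%E.
rewrite ge0_integral_measure_sum //=; apply: eq_bigr => i _.
by rewrite integral_dirac // diracT mul1e inord_val.
Qed.

Lemma ge0_le_integralT (mu : {measure set T -> \bar R}) (f h : T -> \bar R) :
  (forall x, 0 <= f x)%E -> (forall x, f x <= h x)%E ->
  (\int[mu]_x f x <= \int[mu]_x h x)%E.
Proof.
move=> f0 fh; rewrite !ge0_integralTE //; last by move=> x; exact: le_trans (fh x).
apply: ge_ereal_sup => _ [s /= sf <-]; apply: ereal_sup_ubound; exists s => // x.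
exact: le_trans (fh x).
Qed.

(** For arbitrary nonnegative functions, since the masses of the sections of an
arbitrary set are integrated below.  From above, one compares with the simple functions that
define the integral; from below, with the restriction of f to the finite
family, which is measurable because points are. *)
Lemma integral_mean_dirac (f : T -> \bar R) : (forall i, measurable [set g i]) ->
  (forall x, 0 <= f x)%E ->
  (\int[mean_dirac]_x f x = (N.+1%:R^-1)%:E * \sum_(i < N.+1) f (g i))%E.
Proof.
move=> mg f0; apply/eqP; rewrite eq_le; apply/andP; split.
  rewrite ge0_integralTE //; apply: ge_ereal_sup => _ [h /= hf <-].
  rewrite -integralT_nnsfun integral_mean_dirac_measurable; first last.
  - by move=> x; rewrite lee_fin; exact: fun_ge0.
  - by apply/measurable_EFinP; exact: measurable_funPT.
  by rewrite lee_wpmul2l // lee_sum.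
pose F := \bigcup_(i in [set: 'I_N.+1]) [set g i].
pose f' x := if pselect (F x) is left _ then f x else 0%E.
have f'0 x : (0 <= f' x)%E by rewrite /f'; case: pselect.
have mF : measurable F by apply: fin_bigcup_measurable.
have mf' : measurable_fun setT f'.
  move=> _ Y _; rewrite setTI.
  have mFY : measurable (\bigcup_(i in [set i | Y (f (g i))]) [set g i]).
    by apply: fin_bigcup_measurable.
  have [Y0|Y0] := pselect (Y 0%E).
    rewrite (_ : _ @^-1` _ = (\bigcup_(i in [set i | Y (f (g i))]) [set g i]) `|` ~` F).
      by apply: measurableU => //; exact: measurableC.
    apply/seteqP; split => x; rewrite /f' /=.
      case: pselect => [[i _ ->] Yi|nF _]; last by right.
      by left; exists i.
    case=> [[i Yi ->]|nF]; last by case: pselect.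
    by case: pselect => // nF; case: nF; exists i.
  rewrite (_ : _ @^-1` _ = (\bigcup_(i in [set i | Y (f (g i))]) [set g i])) //.
  apply/seteqP; split => x; rewrite /f' /=.
    by case: pselect => [[i _ ->] Yi|//]; exists i.
  by move=> [i Yi ->]; case: pselect => // nF; case: nF; exists i.
have f'f x : (f' x <= f x)%E by rewrite /f'; case: pselect.
apply: le_trans (ge0_le_integralT _ f'0 f'f).
rewrite integral_mean_dirac_measurable // lee_wpmul2l // lee_sum // => i _.
by rewrite /f'; case: pselect => // nF; case: nF; exists i.
Qed.

End mean_dirac.

Lemma probability_agree d (T : measurableType d) (R : realType) (P : probability T R)
    (J A B : set T) : measurable J -> measurable A -> measurable B -> P J = 1%E ->
  (forall x, J x -> A x <-> B x) -> P A = P B.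
Proof.
move=> mJ mA mB J1 AB.
have full C : measurable C -> P C = P (C `&` J).
  move=> mC; rewrite (measureDI P mC mJ) [X in (X + _)%E](_ : _ = 0%E) ?add0e //.
  apply/eqP; rewrite -measure_le0.
  have <- : P (~` J) = 0%E by rewrite probability_setC // J1 subee.
  by apply: le_measure; rewrite ?inE; [exact: measurableD|exact: measurableC|move=> x []].
rewrite full // [RHS]full //; congr (P _).
by apply/seteqP; split => x [] /[swap] Jx /(AB _ Jx).
Qed.

(** * The random walk and its stationary measures *)

Section system.
Variables (R : realType) (l : R) (N : nat) (theta : 'I_N.+1 -> R).
Hypothesis l5 : 5 <= l.
Hypothesis theta_itv : forall i, pi / 2 - pi / 16 <= theta i <= pi / 2 + pi / 16.
Variables (i0 i1 : 'I_N.+1).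
Hypothesis theta01 : 0 < theta i1 - theta i0 < pi / 2.

Let k := l ^- 2.
Let H := branch_map k.
Let a0 : R := pi / 2 - pi / 8.
Let b0 : R := pi / 2 + pi / 8.
Let J : set (measurableTypeR R) := `[a0, b0]%classic.

Let l_gt0 : 0 < l. Proof. by move: l5; lra. Qed.
Let pi0 : 0 < pi :> R. Proof. exact: pi_gt0. Qed.
Let k_gt0 : 0 < k. Proof. by rewrite invr_gt0 exprn_gt0. Qed.

Lemma k_le20 : k <= 20^-1.
Proof.
have l25 : 5 * 5 <= l ^+ 2 by rewrite expr2 ler_pM.
rewrite lef_pV2 ?posrE ?exprn_gt0 //; lra.
Qed.

Let k01 : 0 < k <= 1. Proof. by rewrite k_gt0; move: k_le20; lra. Qed.

Definition gen (i : 'I_N.+1) : borel (PSL2 R) := axis_elt l_gt0 (theta i).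
Definition axis_measure : probability (borel (PSL2 R)) R := mean_dirac R gen.

(** The image of t lies between t and theta i, as H contracts towards 0. *)
Lemma branch_map_itv i t : a0 <= t <= b0 -> a0 <= branch H (theta i) t <= b0.
Proof.
move=> /andP[t1 t2]; have /andP[th1 th2] := theta_itv i; have p := pi0.
have H0 : H 0 = 0 by rewrite /H branch_mapE ?/angle_map ?tan0 ?mulr0 ?atan0 //; apply/andP; split; lra.
rewrite /branch; move: t1 t2; rewrite /a0 /b0; set y := t - theta i => t1 t2.
have yE : y = t - theta i by [].
move: yE; move: (y) => {}y yE.
have k1 := k_le20; have k0 := k_gt0.
have [y0|y0] := leP 0 y.
  have /andP[h1 h2] := branch_map_slope k01 y0.
  move: h1 h2; rewrite -/H H0 !subr0 => h1 h2.
  have : 0 <= k * y by rewrite mulr_ge0 // ltW.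
  have : k * y <= 20^-1 * y by rewrite ler_wpM2r.
  by move=> *; apply/andP; split; lra.
have /andP[h1 h2] := branch_map_slope k01 (ltW y0).
move: h1 h2; rewrite -/H H0 !sub0r => h1 h2.
have : 0 <= k * - y by rewrite mulr_ge0 ?(ltW k0) // oppr_ge0 ltW.
have : k * - y <= 20^-1 * - y by rewrite ler_wpM2r // oppr_ge0 ltW.
by move=> *; apply/andP; split; lra.
Qed.

Lemma gen_line i t : a0 <= t <= b0 ->
  PSL2_act (gen i) (line t) = line (branch H (theta i) t).
Proof.
rewrite /a0 /b0 => /andP[t1 t2]; have /andP[th1 th2] := theta_itv i; have p := pi0.
rewrite -[in LHS](subrKC (theta i) t) /gen axis_elt_line; last by apply/andP; split; lra.
by rewrite /branch /H branch_mapE //; apply/andP; split; lra.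
Qed.

Lemma measurable_gen i : measurable [set gen i].
Proof.
rewrite -[X in measurable X]setCK; apply: measurableC; apply: open_borel.
by rewrite openC; exact: closed_PSL2_set1.
Qed.

Lemma msupport_axis_measure x : msupport axis_measure x <-> exists i, x = gen i.
Proof.
split=> [supp|[i -> ] U oU Ui]; last exact: mean_dirac_gt0 Ui.
apply: contrapT => nx.
have oU : open (~` (\bigcup_(i in [set: 'I_N.+1]) [set (gen i : PSL2 R)])).
  rewrite openC; apply: closed_bigcup; last by move=> i _; exact: closed_PSL2_set1.
  exact: finite_finset.
have mu0 : axis_measure (~` (\bigcup_(i in [set: 'I_N.+1]) [set (gen i : PSL2 R)])) = 0%E.
  by apply: mean_dirac_eq0 => i; apply; exists i.
have : (0 < axis_measure (~` (\bigcup_(i in [set: 'I_N.+1]) [set (gen i : PSL2 R)])))%E.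
  by apply: supp => // -[i _ xi]; apply: nx; exists i.
by rewrite mu0 ltxx.
Qed.

Lemma convolution_axis_measure (nu : probability (borel (P1 R)) R) (A : set (borel (P1 R))) :
  convolution axis_measure nu A = ((N.+1%:R^-1)%:E * \sum_(i < N.+1) nu (PSL2_act (gen i) @^-1` A))%E.
Proof.
rewrite /convolution /pushforward /product_measure1 integral_mean_dirac.
- congr (_ * _)%E; apply: eq_bigr => i _ /=; congr (nu _).
  by apply/seteqP; split => x; rewrite /xsection /= inE.
- exact: measurable_gen.
- by move=> x /=; exact: measure_ge0.
Qed.

Lemma exists_oblique_gen (x : P1 R) :
  exists i t, [/\ i = i0 \/ i = i1, x = line (theta i + t), - (pi / 2) < t < pi / 2 & t != 0].
Proof.
move: theta01 => /andP[h1 h2]; have p := pi0.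
have [||c [t [cE -> t2 t0]]] := @exists_oblique_frame R (theta i0) (theta i1) x.
- by rewrite gt_eqF // sin_gt0_pihalf // h1.
- by rewrite gt_eqF // cos_gt0_pihalf //; apply/andP; split; lra.
by case: cE => ->; [exists i0|exists i1]; exists t; split => //; [left|right].
Qed.

Lemma iter_gen i t n : - (pi / 2) < t < pi / 2 ->
  iter n (PSL2_act (gen i)) (line (theta i + t)) = line (theta i + atan (k ^+ n * tan t)).
Proof. exact: axis_elt_iter. Qed.

(** Every line is oblique to the axis of one of two generators, and has then an
infinite orbit under its powers. *)
Lemma gen_no_finite_invariant_set (F : set (P1 R)) : finite_set F -> F !=set0 ->
  (forall i, PSL2_act (gen i) @` F = F) -> False.
Proof.
move=> finF [x Fx] invF; have [i [t [_ xE t2 t0]]] := exists_oblique_gen x.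
have Fn n : F (iter n (PSL2_act (gen i)) x).
  by elim: n => [//|n IHn]; rewrite iterS -(invF i); exists (iter n (PSL2_act (gen i)) x).
have tt : tan t != 0.
  apply: contraNneq t0 => tt; rewrite -(tanK (x := t)) ?in_itv //= tt.
  by rewrite atan0.
have inj : injective (fun n => iter n (PSL2_act (gen i)) x).
  move=> m n; rewrite xE !iter_gen // => /(congr1 (frame_slope (theta i))).
  rewrite !frame_slope_line !atanK => /(mulIf tt) e.
  have k1 : k < 1 by move: k_le20; lra.
  by apply/eqP; rewrite eqn_leq -!(ler_iXn2l k_gt0 k1) e lexx.
apply: infinite_nat.
rewrite (_ : setT = (fun n => iter n (PSL2_act (gen i)) x) @^-1` F).
  by apply: finite_preimage => // m n _ _; exact: inj.
by apply/seteqP; split => n // _; exact: Fn.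
Qed.

Lemma gen_no_compact_subgroup (K : set (PSL2 R)) :
  subgroup K -> compact K -> K (gen i0) -> False.
Proof.
move=> [K1 Kdiv] cK Kg.
have Kinv x : K x -> K x^-1%g by move=> Kx; rewrite -[X in K X]mul1g; exact: Kdiv.
have Kmul x y : K x -> K y -> K (x * y)%g.
  by move=> Kx Ky; rewrite -[y]invgK; apply: Kdiv => //; exact: Kinv.
have Kpow n : K ((gen i0 : PSL2 R) ^+ n)%g.
  by elim: n => [|n IHn]; rewrite ?expg0 // expgS; exact: Kmul.
have cT : compact (@abs_trace R @` K).
  apply: continuous_compact => //; apply: continuous_subspaceT; exact: continuous_abs_trace.
have [M [_ HM]] := compact_bounded cT.
have bound n : l ^+ n <= M + 1.
  have := HM (M + 1); rewrite ltrDl ltr01 => /(_ isT (abs_trace ((gen i0 : PSL2 R) ^+ n)%g)).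
  rewrite /= /gen axis_elt_expg abs_trace_class trace_axis_elt.
  have l0 : 0 <= l ^- n by rewrite invr_ge0 exprn_ge0 // ltW.
  have ln0 : 0 <= l ^+ n by rewrite exprn_ge0 // ltW.
  rewrite normr_id ger0_norm ?addr_ge0 // => h.
  apply: le_trans (h _); first by rewrite lerDl.
  exists ((gen i0 : PSL2 R) ^+ n)%g; first exact: Kpow.
  by rewrite /gen axis_elt_expg abs_trace_class trace_axis_elt ger0_norm // addr_ge0.
have lin n : n%:R <= l ^+ n.
  elim: n => [|n IHn]; first by rewrite expr0 ler01.
  rewrite exprS -natr1.
  have : 5 * l ^+ n <= l * l ^+ n by rewrite ler_wpM2r // exprn_ge0 // ltW.
  have : 1 <= l ^+ n by rewrite exprn_ege1 //; move: l5; lra.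
  by move: IHn; lra.
have := unstable.ltr_bound (M + 1); apply/negP; rewrite -leNgt.
exact: le_trans (lin _) (bound _).
Qed.

Lemma zariski_dense_axis_measure : zariski_dense axis_measure.
Proof.
split=> [[K [sK cK supp]]|[F [finF F0 invF]]].
  by apply: (gen_no_compact_subgroup sK cK); apply: supp; apply/msupport_axis_measure; exists i0.
apply: (gen_no_finite_invariant_set finF F0) => i; apply: invF.
by apply/msupport_axis_measure; exists i.
Qed.

Lemma finite_msupport_axis_measure : finite_set (msupport axis_measure).
Proof.
apply: (@sub_finite_set _ _ ((gen : _ -> PSL2 R) @` [set: 'I_N.+1])).
  by move=> x /msupport_axis_measure[i ->]; exists i.
exact/finite_image.
Qed.

Lemma gen_conjugate r i : r <= l -> exists kk d : PSL2 R,
  [/\ is_rotation kk, is_diag_ge r d & (gen i : PSL2 R) = (kk * d * kk^-1)%g].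
Proof.
move=> rl; exists (PSL2_class (rot (theta i))), (PSL2_class (diag_elt l_gt0)); split => //.
  by exists (theta i).
exists (diag_elt l_gt0); split => //; first exact: diag_mx_is_diag.
by rewrite !mxE /= le_max mulr1n rl.
Qed.

Section stationary_measures.
Variable nuR : probability (measurableTypeR R) R.
Hypothesis nuR_self_similar : self_similar H theta nuR.
Hypothesis nuR_J : nuR J = 1%E.

Let mJ : measurable J. Proof. exact: measurable_itv. Qed.

Lemma measurable_line_preimage (A : set (borel (P1 R))) : measurable A ->
  measurable (@line R @^-1` A : set (measurableTypeR R)).
Proof. by move=> mA; rewrite -[X in measurable X]setTI; exact: measurable_line. Qed.

Lemma measurable_angle_preimage (B : set (measurableTypeR R)) : measurable B ->
  measurable (@angle R @^-1` B : set (borel (P1 R))).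
Proof. by move=> mB; rewrite -[X in measurable X]setTI; exact: measurable_angle. Qed.

Lemma measurable_act_preimage (g : PSL2 R) (A : set (borel (P1 R))) : measurable A ->
  measurable (PSL2_act g @^-1` A : set (borel (P1 R))).
Proof. by move=> mA; rewrite -[X in measurable X]setTI; exact: measurable_PSL2_act. Qed.

Let mbranch i (B : set (measurableTypeR R)) : measurable B ->
  measurable (branch H (theta i) @^-1` B).
Proof.
exact: (measurable_branch k_gt0 k_le20 (fun a b => branch_map_slope k01)).
Qed.

Variable nu : probability (borel (P1 R)) R.
Hypothesis nuE : forall A, nu A = nuR (@line R @^-1` A).

Lemma stationary_nu : stationary axis_measure nu.
Proof.
move=> A mA; rewrite convolution_axis_measure nuE nuR_self_similar; last exact: measurable_line_preimage.
congr (_ * _)%E; apply: eq_bigr => i _; rewrite nuE.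
apply: (probability_agree mJ) => //.
- by apply: mbranch; exact: measurable_line_preimage.
- by apply: measurable_line_preimage; exact: measurable_act_preimage.
- by move=> t; rewrite /J /= in_itv /= => Jt; rewrite gen_line.
Qed.

Lemma J_0pi t : a0 <= t <= b0 -> 0 < t < pi.
Proof. by rewrite /a0 /b0 => /andP[t1 t2]; have p := pi0; apply/andP; split; lra. Qed.

Definition arc : set (borel (P1 R)) := (@non_horizontal R) `&` @angle R @^-1` J.

Lemma measurable_arc : measurable arc.
Proof.
by apply: measurableI; [exact: measurable_non_horizontal|exact: measurable_angle_preimage].
Qed.

Lemma arc_line t : a0 <= t <= b0 -> arc (line t).
Proof.
move=> Jt; have t0 := J_0pi Jt; split.
  by apply/non_horizontalP; rewrite /= vec21 gt_eqF // sin_gt0_pi.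
by rewrite /= angle_line // in_itv.
Qed.

Lemma arc_angle x : arc x -> a0 <= angle x <= b0 /\ x = line (angle x).
Proof. by move=> [nx]; rewrite /J /= in_itv /= => Jx; split => //; rewrite line_angle. Qed.

Lemma arc_gen i x : arc x -> arc (PSL2_act (gen i) x).
Proof.
move=> /arc_angle[Jx ->]; rewrite gen_line //; apply: arc_line; exact: branch_map_itv.
Qed.

Lemma iter_gen_arc x : exists i n, arc (iter n (PSL2_act (gen i)) x).
Proof.
have [i [t [_ -> t2 _]]] := exists_oblique_gen x; exists i.
have p := pi0; pose e : R := tan (pi / 16).
have e0 : 0 < e.
  rewrite /e /tan divr_gt0 ?sin_gt0_pihalf ?cos_gt0_pihalf //; apply/andP; split; lra.
have kk : 0 <= k < 1 by rewrite ltW //=; move: k_le20; lra.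
have [n /(_ n (leqnn n)) small] := geometric_le (`|tan t|) kk e0.
exists n; rewrite iter_gen //; apply: arc_line.
set s := k ^+ n * tan t.
have se : `|s| <= e by rewrite normrM ger0_norm ?exprn_ge0 // ltW.
have p16 : atan e = pi / 16 by rewrite /e tanK // in_itv /=; apply/andP; split; lra.
move: se; rewrite ler_norml => /andP[/le_atan s1 /le_atan s2]; move: s1 s2.
rewrite atanN p16 => s1 s2; have /andP[th1 th2] := theta_itv i.
by rewrite /a0 /b0; apply/andP; split; lra.
Qed.

Lemma fine_stationary (nu' : probability (borel (P1 R)) R) A :
  stationary axis_measure nu' -> measurable A ->
  fine (nu' A) = N.+1%:R^-1 * \sum_(i < N.+1) fine (nu' (PSL2_act (gen i) @^-1` A)).
Proof.
move=> st mA; rewrite st // convolution_axis_measure.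
have fin (i : 'I_N.+1) : nu' (PSL2_act (gen i) @^-1` A) \is a fin_num.
  by apply: fin_num_measure; exact: measurable_act_preimage.
rewrite fineM //; last by apply/sum_fin_numP => i _ _; exact: fin.
by rewrite /= -sum_fine // => i _; exact: fin.
Qed.

(** The equality case of the comparison of a mean with a lower bound. *)
Lemma mean_eq_lower_bound (c : R) (F : 'I_N.+1 -> R) : (forall i, c <= F i) ->
  c = N.+1%:R^-1 * \sum_(i < N.+1) F i -> forall i, F i = c.
Proof.
move=> cF cE i; apply/eqP; rewrite -subr_eq0; apply/eqP.
have : \sum_(i < N.+1) (F i - c) = 0.
  by rewrite sumrB sum_letters [in X in _ - X]cE mulrA mulfV ?mul1r ?subrr.
by move=> /psumr_eq0P; apply => // j _; rewrite subr_ge0.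
Qed.

Lemma stationary_pullback_null (nu' : probability (borel (P1 R)) R) i Z :
  stationary axis_measure nu' ->
  measurable Z -> nu' Z = 0%E -> nu' (PSL2_act (gen i) @^-1` Z) = 0%E.
Proof.
move=> st mZ Z0; have := fine_stationary st mZ; rewrite Z0 /=.
move=> /(mean_eq_lower_bound (fun i => fine_ge0 (measure_ge0 _ _))) /(_ i) h.
by rewrite -[LHS]fineK ?h // fin_num_measure //; exact: measurable_act_preimage.
Qed.

(** The arc and its preimage have the same mass: the arc is contained in all of
its preimages, and the mean of their masses is its own mass. *)
Lemma stationary_escape_null (nu' : probability (borel (P1 R)) R) i :
  stationary axis_measure nu' ->
  nu' (PSL2_act (gen i) @^-1` arc `\` arc) = 0%E.
Proof.
move=> st; have mA := measurable_arc; have mg j := measurable_act_preimage (gen j) mA.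
have fin C : measurable C -> nu' C \is a fin_num by move=> mC; exact: fin_num_measure.
have le j : fine (nu' arc) <= fine (nu' (PSL2_act (gen j) @^-1` arc)).
  apply: fine_le; rewrite ?fin //; apply: le_measure; rewrite ?inE //.
  by move=> x; exact: arc_gen.
have := mean_eq_lower_bound le (fine_stationary st mA) i => e.
rewrite measureD //; last by rewrite -ge0_fin_numE // fin.
rewrite setIidr; last by move=> x; exact: arc_gen.
rewrite -[X in (X - _)%E]fineK ?fin // -[X in (_ - X)%E]fineK ?fin // e.
by rewrite -EFinB subrr.
Qed.

(** Every point outside of the arc enters it under the powers of some generator,
and the step at which it enters is a null event by the two previous lemmas. *)
Lemma stationary_arc (nu' : probability (borel (P1 R)) R) :
  stationary axis_measure nu' -> nu' arc = 1%E.
Proof.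
move=> st; have mA := measurable_arc.
pose Z i : set (borel (P1 R)) := PSL2_act (gen i) @^-1` arc `\` arc.
have mZ i : measurable (Z i) by apply: measurableD => //; exact: measurable_act_preimage.
pose W i n : set (borel (P1 R)) := iter n (PSL2_act (gen i)) @^-1` Z i.
have WS i n : W i n.+1 = PSL2_act (gen i) @^-1` W i n.
  by apply/seteqP; split => x; rewrite /W /preimage /= -iterSr.
have mW i n : measurable (W i n).
  elim: n => [|n IHn]; first exact: mZ.
  by rewrite WS; exact: measurable_act_preimage.
have W0 i n : nu' (W i n) = 0%E.
  elim: n => [|n IHn]; first exact: stationary_escape_null.
  by rewrite WS; exact: stationary_pullback_null.
have cover : ~` arc `<=` \bigcup_m \bigcup_n W (inord m) n.
  move=> x nx; have [i [n]] := iter_gen_arc x.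
  elim: n => [//|n IHn] xn.
  have [|xn'] := pselect (arc (iter n (PSL2_act (gen i)) x)); first exact: IHn.
  by exists i => //; exists n => //; rewrite inord_val; split.
have : nu'.-negligible (~` arc).
  apply: negligibleS cover _; apply: negligible_bigcup => m; apply: negligible_bigcup => n.
  by apply/(negligibleP _ (mW _ _)); exact: W0.
move=> /(negligibleP _ (measurableC mA)) C0.
have {}C0 : nu' (~` arc) = 0%E by exact: C0.
have := probability_setC nu' mA; rewrite C0 => /esym/eqP.
by rewrite sube_eq ?fin_num_measure // add0e => /eqP ->.
Qed.

(** A stationary measure lives on the arc, where the angle conjugates the
generators to the branches; so its image under the angle is the self-similar
measure. *)
Lemma furstenberg_nu : is_furstenberg_measure axis_measure nu.
Proof.
split=> [|nu' st A mA]; first exact: stationary_nu.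
have mar := measurable_arc; have ar1 := stationary_arc st.
have [nuR' nuR'E] := exists_image_probability (P := nu') measurableT
  (@measurable_angle R) (probability_setT _).
have nuR'J : nuR' J = 1%E.
  apply/eqP; rewrite eq_le probability_le1 //= nuR'E setTI -ar1.
  by apply: le_measure; rewrite ?inE //; [exact: measurable_angle_preimage|move=> x []].
have ss' : self_similar H theta nuR'.
  move=> B mB; rewrite nuR'E setTI.
  apply: eq_trans (st _ (measurable_angle_preimage mB)) _; rewrite convolution_axis_measure.
  congr (_ * _)%E; apply: eq_bigr => i _; rewrite nuR'E setTI.
  apply: (probability_agree mar) => //.
  - by apply: measurable_act_preimage; exact: measurable_angle_preimage.
  - by apply: measurable_angle_preimage; exact: mbranch.
  - move=> x /arc_angle[Jx ->]; rewrite /= gen_line // !angle_line //; first exact: J_0pi.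
    exact: J_0pi (branch_map_itv _ _).
rewrite nuE.
have ab : a0 <= b0 by have p := pi0; rewrite /a0 /b0; lra.
rewrite -(self_similar_unique k_gt0 k_le20 (fun a b => branch_map_slope k01) ab
  nuR_self_similar nuR_J ss' nuR'J); last exact: measurable_line_preimage.
rewrite nuR'E setTI; apply: (probability_agree mar) => //.
  by apply: measurable_angle_preimage; exact: measurable_line_preimage.
by move=> x /arc_angle[_ xE]; rewrite /= -xE.
Qed.

Lemma nu_dominated : (forall A : set (measurableTypeR R), measurable A ->
    lebesgue_measure A = 0%E -> nuR A = 0%E) -> nu `<< @P1_lebesgue R.
Proof.
move=> ac A nullA B mB BA; have := nullA B mB BA; rewrite /P1_lebesgue nuE => B0.
have mlB := measurable_line_preimage mB.
have mB' : measurable ([set t : R | 0 <= t < pi /\ B (line t)] : set (measurableTypeR R)).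
  rewrite (_ : [set t | _] = `[0, pi[%classic `&` @line R @^-1` B).
    by apply: measurableI => //; exact: measurable_itv.
  by apply/seteqP; split => t /=; rewrite in_itv.
rewrite (@probability_agree _ (measurableTypeR R) R nuR J _
  [set t : R | 0 <= t < pi /\ B (line t)] mJ mlB mB' nuR_J).
- exact: ac.
- by move=> t; rewrite /J /= in_itv /= => /J_0pi /andP[t1 t2]; rewrite t2 ltW //; split => // -[].
Qed.

End stationary_measures.
End system.

Theorem corollary1p11 (R : realType) (r : R) (hr : 0 < r) :
  exists mu : probability (borel (PSL2 R)) R,
    [/\ zariski_dense mu,
        finite_set (msupport mu),
        forall g : PSL2 R, msupport mu g ->
          exists k d : PSL2 R,
            [/\ is_rotation k, is_diag_ge r d & g = (k * d * k^-1)%g]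
      & exists nu : probability (borel (P1 R)) R,
          is_furstenberg_measure mu nu /\ nu `<< @P1_lebesgue R].
Proof.
(* l >= 5 makes l^-2 <= 1/20 *)
pose l := Num.max r 5; pose k : R := l ^- 2.
have l5 : 5 <= l by rewrite /l le_max lexx orbT.
have rl : r <= l by rewrite /l le_max lexx.
have l0 : 0 < l by move: l5; lra.
have k0 : 0 < k by rewrite invr_gt0 exprn_gt0.
have ks : k <= 20^-1 by exact: k_le20.
have k01 : 0 < k <= 1 by rewrite k0; move: ks; lra.
have p : 0 < pi :> R by exact: pi_gt0.
pose N := Num.bound (2 / k).
have kN : 2 <= k * N.+1%:R.
  rewrite mulrC -ler_pdivrMr //; apply: le_trans (ltW (unstable.ltr_bound _)) _.
  by rewrite ler_nat.
have N1 : (0 < N)%N.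
  rewrite lt0n; apply/eqP => N0; move: kN; rewrite N0 mulr1; move: ks; lra.
have i01 : ord_max != ord0 :> 'I_N.+1 by apply/eqP => /(congr1 val) /= N0; move: N1; rewrite N0.
(* the offset keeps the first axis away from the others *)
pose beta (i : 'I_N.+1) : R := if i == ord0 then pi / 2 - pi / 16 else pi / 2.
have slope := fun a b => @branch_map_slope R k a b k01.
have wd0 : 0 < pi / 32 :> R by rewrite divr_gt0.
have [theta theta_beta near_theta] := exists_limit_near_pairs (pi / 2) k0 ks kN slope beta wd0.
have theta_itv i : pi / 2 - pi / 16 <= theta i <= pi / 2 + pi / 16.
  have := theta_beta i; rewrite /beta; case: ifP => _ /andP[h1 h2]; apply/andP; split; lra.
have theta01 : 0 < theta ord_max - theta ord0 < pi / 2.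
  have := theta_beta ord0; have := theta_beta ord_max.
  rewrite /beta eqxx (negbTE i01) => /andP[h1 h2] /andP[h3 h4].
  by apply/andP; split; lra.
have ab : pi / 2 - pi / 8 <= pi / 2 + pi / 8 :> R by lra.
have [nuR [ss J1]] := exists_self_similar k0 ks slope ab (branch_map_itv l5 theta_itv).
have [nu nuE] := exists_image_probability (P := nuR) measurableT
  (@measurable_line R) (probability_setT _).
exists (axis_measure theta l5); split.
- exact: (zariski_dense_axis_measure l5 theta01).
- exact: finite_msupport_axis_measure.
- by move=> g /msupport_axis_measure[i ->]; exact: gen_conjugate.
exists nu; have {}nuE A : nu A = nuR (@line R @^-1` A) by rewrite nuE setTI.
split; first by apply: (furstenberg_nu l5 theta_itv theta01 ss J1 nuE).
apply: (nu_dominated (nuR := nuR)) => // A mA A0.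
apply: (self_similar_null k0 ks kN slope _ near_theta _ ss J1) => //.
  by apply/andP; split; lra.
by rewrite addr_ge0 // divr_ge0 // ltW.
Qed.
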